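(* Let $\mu>0$. There is an absolute constant $\delta>0$ for which the following holds. Let $\frac32<\theta\le 2$. There exists a divergence-free initial datum $u_0\in L^2(\mathbb T^3)$, depending only on $\theta$, such that for every $1<r\le\infty$ for which the pair $(r,\theta)$ satisfies either $$2\le \theta+\frac3r<3,$$ or $$r\ge \frac32,\qquad 3\le \theta+\frac3r<4,\qquad 2\theta+\frac3r\le \frac{11}{2},$$ one has $u_0\in B^{\frac3r+\theta-3}_{r,\infty}(\mathbb T^3)$, and every Leray-Hopf weak solution $u\in C_w([0,T);L^2)\cap L^2([0,T);H^1)$ of the Navier-Stokes equations on $\mathbb T^3$ with initial datum $u(0)=u_0$ satisfies $$\limsup_{t\to 0+}\|u(t)-u_0\|_{B^{\frac3r+\theta-3}_{r,\infty}}\ge \delta .$$ (Here $\frac3r=0$ if $r=\infty$.)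
   Context: The Navier-Stokes equations on the torus $\mathbb T^3$ (functions $2\pi$-periodic in each variable) with viscosity $\mu>0$ are $$u_t-\mu\Delta u+u\cdot\nabla u+\nabla p=0,\qquad \nabla\cdot u=0 .$$ A Leray-Hopf weak solution on $[0,T)$ with divergence-free initial datum $u_0\in L^2$ is a divergence-free vector field $u\in C_w([0,T);L^2)\cap L^2([0,T);H^1)$ ($C_w$ denoting weak continuity in time with values in $L^2$) that solves the equations in the sense of distributions, satisfies $u(0)=u_0$, and satisfies the energy inequality $\|u(t)\|_{L^2}^2+2\mu\int_0^t\|\nabla u(s)\|_{L^2}^2\,ds\le\|u_0\|_{L^2}^2$ for $t\in(0,T)$. Besov norm: put $\lambda_q=2^q$. Let $\chi\in C_0^\infty(\mathbb R^3)$ be a nonnegative radial function with $\chi(\xi)=1$ for $|\xi|\le\frac34$ and $\chi(\xi)=0$ for $|\xi|\ge1$. Let $\varphi(\xi)=\chi(\xi/2)-\chi(\xi)$, $\varphi_q(\xi)=\varphi(\lambda_q^{-1}\xi)$ for $q\ge0$, and $\varphi_{-1}=\chi$. For a periodic distribution $v$ with Fourier coefficients $\hat v(k)$, set $v_q(x)=\sum_{k\in\mathbb Z^3}\hat v(k)\varphi_q(k)e^{ik\cdot x}$, $q\ge-1$. Then $\|v\|_{B^s_{r,\infty}}=\sup_{q\ge-1}\lambda_q^s\|v_q\|_{L^r}$, and $B^s_{r,\infty}(\mathbb T^3)$ is the space of periodic distributions for which this norm is finite. *)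

(* Defs.v *)
From HB Require Import structures.
From mathcomp Require Import all_boot all_order all_algebra.
From mathcomp Require Import all_classical all_reals all_analysis.
From mathcomp Require Import complex.

Set Implicit Arguments.
Unset Strict Implicit.
Unset Printing Implicit Defensive.

Import Order.TTheory GRing.Theory Num.Theory.
Import numFieldNormedType.Exports.

Local Open Scope classical_set_scope.
Local Open Scope ring_scope.

(* The library's norm on [vec3 R] is the sup norm; [enorm] is Euclidean. *)
Notation vec3 R := (R * R * R)%type.

(* The same type with the sigma-algebra on which [lebesgue_measure] lives. *)
Notation mvec3 R :=
  (measurableTypeR R * measurableTypeR R * measurableTypeR R)%type.

Section Space.
Context {R : realType}.

Definition crd (x : vec3 R) (j : 'I_3) : R := [:: x.1.1; x.1.2; x.2]`_j.

Definition basis3 (j : 'I_3) : vec3 R :=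
  ((val j == 0%N)%:R, (val j == 1%N)%:R, (val j == 2%N)%:R).

Definition dot (x y : vec3 R) : R := \sum_(j < 3) crd x j * crd y j.

Definition enorm (x : vec3 R) : R := Num.sqrt (dot x x).

Definition vec_of_int (k : int * int * int) : vec3 R :=
  (k.1.1%:~R, k.1.2%:~R, k.2%:~R).

Definition periodic (f : vec3 R -> R) : Prop :=
  forall x j, f (x + (2 * pi) *: basis3 j) = f x.

Definition iter_derive {V : normedModType R} (s : seq V) (f : V -> R) : V -> R :=
  foldr (fun v g => 'D_v g) f s.

(* On a finite-dimensional [V] this is the class C^oo. *)
Definition smooth {V : normedModType R} (f : V -> R) : Prop :=
  forall s : seq V, continuous (iter_derive s f) /\
                    forall x v, derivable (iter_derive s f) x v.

End Space.

(* Functions on the torus are 2 pi-periodic functions on R^3, integrated over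
   the cell [0, 2 pi[^3 against the (unnormalized) Lebesgue measure. *)
Section TorusMeasure.
Variable R : realType.

Let mu : {measure set (measurableTypeR R) -> \bar R} := lebesgue_measure.

Let cell1 : set (measurableTypeR R) := `[0, 2 * pi[%classic.

Let measurable_cell1 : measurable cell1.
Proof. exact: measurable_itv. Qed.

Let cell1_finite : (mu cell1 < +oo)%E.
Proof.
rewrite /mu /cell1 /= lebesgue_measure_itv /=.
by case: ifP => _; rewrite ?ltry // -EFinB ltry.
Qed.

Definition circle_measure : {finite_measure set (measurableTypeR R) -> \bar R} :=
  mfrestr measurable_cell1 cell1_finite.

Definition torus_measure : {measure set (mvec3 R) -> \bar R} :=
  ((circle_measure \x circle_measure) \x circle_measure)%E.

End TorusMeasure.

Section Fields.
Context {R : realType}.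

Local Notation T3 := (torus_measure R).

Definition vfield := 'I_3 -> vec3 R -> R.

Definition L2fun (f : vec3 R -> R) : Prop :=
  [/\ periodic f, measurable_fun [set: mvec3 R] (f : mvec3 R -> R) & (\int[T3]_x (f x ^+ 2)%:E < +oo)%E].

Definition L2field (v : vfield) : Prop := forall i, L2fun (v i).

Definition L2sq (v : vfield) : \bar R :=
  (\int[T3]_x (\sum_(i < 3) v i x ^+ 2)%:E)%E.

Definition L2inner (v w : vfield) : R :=
  \int[T3]_x (\sum_(i < 3) v i x * w i x).

Definition L2eq (v w : vfield) : Prop :=
  forall i, {ae T3, forall x, v i x = w i x}.

Definition fsub (v w : vfield) : vfield := fun i x => v i x - w i x.

Definition divfree (v : vfield) : Prop :=
  forall psi : vec3 R -> R, smooth psi -> periodic psi ->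
    \int[T3]_x (\sum_(j < 3) v j x * 'D_(basis3 j) psi x) = 0.

(* [G i j] is the weak derivative of [v i] in the direction [j]. *)
Definition weak_gradient (v : vfield) (G : 'I_3 -> vfield) : Prop :=
  forall i j, L2fun (G i j) /\
    forall psi : vec3 R -> R, smooth psi -> periodic psi ->
      \int[T3]_x (v i x * 'D_(basis3 j) psi x) = - \int[T3]_x (G i j x * psi x).

End Fields.

Section LittlewoodPaley.
Context {R : realType}.
Local Open Scope complex_scope.

Definition cutoff (chi : vec3 R -> R) : Prop :=
  [/\ smooth chi,
      (forall xi, 0 <= chi xi),
      (forall xi eta, enorm xi = enorm eta -> chi xi = chi eta),
      (forall xi, enorm xi <= 3 / 4 -> chi xi = 1) &
      (forall xi, 1 <= enorm xi -> chi xi = 0)].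

Definition lambda (q : int) : R := (2 : R) ^ q.

Definition phi (chi : vec3 R -> R) (xi : vec3 R) : R :=
  chi (2^-1 *: xi) - chi xi.

Definition phi_ (chi : vec3 R -> R) (q : int) (xi : vec3 R) : R :=
  if q == -1 then chi xi else phi chi ((lambda q)^-1 *: xi).

Definition expi (a : R) : R[i] := cos a +i* sin a.

Definition fourier (v : @vfield R) (i : 'I_3) (k : int * int * int) : R[i] :=
  ((2 * pi) ^- 3 * \int[torus_measure R]_x (v i x * cos (dot (vec_of_int k) x)))
  -i* ((2 * pi) ^- 3 *
       \int[torus_measure R]_x (v i x * sin (dot (vec_of_int k) x))).

(* [\sum_(k \in _)] is the sum over the support of the summand, which is
   finite here because [phi_ chi q] is compactly supported. *)
Definition lp_block (chi : vec3 R -> R) (q : int) (v : vfield)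
    (i : 'I_3) (x : vec3 R) : R[i] :=
  \sum_(k \in [set: int * int * int])
    (fourier v i k * (phi_ chi q (vec_of_int k))%:C
     * expi (dot (vec_of_int k) x)).

Definition cmod (z : 'I_3 -> R[i]) : R :=
  Num.sqrt (\sum_(i < 3) (complex.Re (z i) ^+ 2 + complex.Im (z i) ^+ 2)).

Definition besov_norm (chi : vec3 R -> R) (s : R) (r : \bar R) (v : vfield) :
    \bar R :=
  ereal_sup [set ((lambda q `^ s)%:E *
      Lnorm (torus_measure R) r (fun x => (cmod (lp_block chi q v ^~ x))%:E))%E
    | q in [set q : int | -1 <= q]].

Definition three_over (r : \bar R) : R :=
  if r is r'%:E then 3 / r' else 0.

End LittlewoodPaley.

Section NavierStokes.
Context {R : realType}.
Implicit Types (T : \bar R) (phi : R * vec3 R -> R).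

Local Notation T3 := (torus_measure R).

Definition dt phi : R * vec3 R -> R := 'D_((1, 0) : R * vec3 R) phi.

Definition dx (j : 'I_3) phi : R * vec3 R -> R :=
  'D_((0, basis3 j) : R * vec3 R) phi.

Definition laplacian phi : R * vec3 R -> R :=
  fun z => \sum_(j < 3) dx j (dx j phi) z.

Definition supported_in (a b : R) phi : Prop :=
  forall t x, phi (t, x) != 0 -> a <= t <= b.

(* Test functions on ]0, T[ x T^3. *)
Definition test_function T phi : Prop :=
  [/\ smooth phi, (forall t, periodic (fun x => phi (t, x))) &
      exists a b : R, [/\ 0 < a, (b%:E < T)%E & supported_in a b phi]].

(* Distributions on ]0, T[ x T^3: linear forms on test functions bounded, on
   each compact time interval, by a C^N norm. Only the values of [p] on test
   functions are meaningful. *)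
Definition distribution_on T (p : (R * vec3 R -> R) -> R) : Prop :=
  (forall a phi psi, test_function T phi -> test_function T psi ->
     p (fun z => a * phi z + psi z) = a * p phi + p psi) /\
  (forall a b : R, 0 < a -> (b%:E < T)%E ->
     exists (N : nat) (C : R), forall phi (M : R),
       test_function T phi -> supported_in a b phi ->
       (forall s : seq (R * vec3 R), (size s <= N)%N ->
          (forall v, v \in s -> `|v| <= 1) ->
          forall z, `|iter_derive s phi z| <= M) ->
       `|p phi| <= C * M).

(* [u t i x] is the i-th component of the velocity at time [t]; [u] is only
   relevant for [t] in [0, T[. [G t] is the gradient of [u t] for almost
   every [t] and [p] is the pressure. Weak continuity of [u] makes the time
   integrands below measurable, so no joint measurability is required. *)
Definition leray_hopf (mu : R) T (u0 : vfield) (u : R -> vfield) : Prop :=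
  exists (G : R -> 'I_3 -> vfield) (p : (R * vec3 R -> R) -> R),
  let time := [set t : R | 0 < t /\ (t%:E < T)%E] in
  let time0 := [set t : R | 0 <= t /\ (t%:E < T)%E] in
  [/\ (forall t, time0 t -> L2field (u t) /\ divfree (u t)) /\
      (forall w, L2field w ->
         {within time0, continuous (fun t => L2inner (u t) w)}),
      {ae lebesgue_measure, forall t, time t -> weak_gradient (u t) (G t)} /\
      (\int[lebesgue_measure]_(t in time)
         (L2sq (u t) + \sum_(i < 3) L2sq (G t i)) < +oo)%E,
      L2eq (u 0) u0,
      distribution_on T p /\
      (forall (i : 'I_3) phi, test_function T phi ->
         \int[lebesgue_measure]_(t in time)
           (\int[T3]_x
              (- (u t i x * dt phi (t, x))
               - mu * (u t i x * laplacian phi (t, x))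
               + (\sum_(j < 3) u t j x * G t i j x) * phi (t, x)))
         - p (dx i phi) = 0) &
      forall t, time t ->
        (L2sq (u t) + (2 * mu)%:E *
           \int[lebesgue_measure]_(s in `]0%R, t[) (\sum_(i < 3) L2sq (G s i))
         <= L2sq u0)%E].

End NavierStokes.

(* Main.v *)
(* For almost every t > 0 the field u(t) lies in H^1, so that its blocks
   satisfy sup |u(t)_q| = o(lambda_q). The datum is built so that its blocks
   violate this on every dyadic shell q >= 4: with n = 2^p and q = p + 4 it is
     u0 = sum_p n^(-theta-4) U_p,
     U_p = (sum a_2 cos((a+b).x), - sum a_1 cos((a+b).x), 0),
   where a and b range over the integer points of [5n,6n[^3. All the
   frequencies a+b lie in the part of the shell on which phi_q = 1, and each
   component of U_p is a product of two Dirichlet kernels, hence is bounded by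
   n^7 in sup norm and by n^4 in L^1; interpolation gives the upper bound
   lambda_q^(3-theta-3/r) for the L^r norm of the q-th block of u0, for all
   r > 1 at once. Since the frequencies are at most a multiple of n, all the
   cosines are at least 1/2 on a cube of side comparable to 1/n, where the
   q-th block is therefore at least lambda_q^(3-theta) >= c lambda_q and
   dominates u(t)_q for q large. Hence u(t) - u0 has norm at least delta for
   almost every t > 0. *)
Require Import Defs.
From HB Require Import structures.
From mathcomp Require Import all_boot all_order all_algebra.
From mathcomp Require Import all_classical all_reals all_analysis.
From mathcomp Require Import measurable_realfun ess_sup_inf.
From mathcomp Require Import complex zify ring lra.
Import Defs.

Import Order.TTheory GRing.Theory Num.Theory.
Import numFieldNormedType.Exports.

Local Open Scope classical_set_scope.
Local Open Scope ring_scope.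

(** * Calculus on the torus *)

(** The two ends of the range of theta are two constraints on the amplitude. Up to a constant, the
    squared L^2 norm of the p-th term is at most its sup norm times its L^1 norm, n^(3-2 theta),
    which decreases geometrically exactly when theta > 3/2. And theta <= 2 makes the peak
    n^(3-theta) at least n, the size below which the q-th block of an H^1 field eventually falls.
    That last fact is an inequality of Bernstein type: about lambda^3 frequencies carry coefficients
    whose squares sum to O(lambda^-2). The product form of U_p serves the L^1 bound: Cauchy-Schwarz
    and Parseval give n * n^(3/2) * n^(3/2) without any pointwise estimate of the kernels. A peak
    n^7 on a cube of volume n^-3 has the same mass n^4, so the upper and lower bounds of the L^r
    norm carry the same power of n for every r. This power cancels against the Besov weight, which
    lets one delta serve all r. Both ranges of (r, theta) give s >= -1 for s = 3/r + theta - 3; this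
    keeps the factor 16^s left over from lambda_q = 16 n away from 0. *)

Section TorusCalculus.
Context {R : realType}.
Implicit Types (F g : vec3 R -> R).
Local Notation T3 := (torus_measure R).
Local Notation C := (circle_measure R).

(** By second countability: an open set is the union of the countably many sup-norm balls with
    rational centre and radius [1 / (n + 1)] that it contains, and each such ball is a product of
    three intervals. *)
Lemma measurable_open_vec3 (U : set (vec3 R)) : open U ->
  measurable (U : set (mvec3 R)).
Proof.
move=> oU.
pose c (p : rat * rat * rat) : vec3 R := (ratr p.1.1, ratr p.1.2, ratr p.2).
pose B (p : (rat * rat * rat) * nat) : set (vec3 R) :=
  ball (c p.1) p.2.+1%:R^-1.
have -> : U = \bigcup_p (if `[<B p `<=` U>] then B p else set0).
  apply/seteqP; split => [x Ux|x [p _]]; last by case: asboolP => // + xp; apply.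
  have [e /= e0 xeU] : exists2 e : R, 0 < e & ball x e `<=` U.
    exact/nbhs_ballP/(open_nbhs_nbhs (conj oU Ux)).
  have [n /= nlt] : exists n : nat, n.+1%:R^-1 < e / 2.
    by exists (Num.truncn (e / 2)^-1); rewrite invf_plt ?posrE ?divr_gt0// truncnS_gt.
  have n0 : 0 < n.+1%:R^-1 :> R by rewrite invr_gt0.
  have rat_near (t : R) : exists q : rat, ball (ratr q : R) n.+1%:R^-1 t.
    move: n0; set d := _^-1 => d0.
    have [|q] := @rat_in_itvoo R (t - d) (t + d); first by lra.
    rewrite in_itv/= => /andP[q1 q2]; exists q.
    by rewrite /ball/= ltr_norml; apply/andP; split; lra.
  have [q1 h1] := rat_near x.1.1.
  have [q2 h2] := rat_near x.1.2.
  have [q3 h3] := rat_near x.2.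
  have xB : B ((q1, q2, q3), n) x by split => //; split.
  exists ((q1, q2, q3), n) => //; case: asboolP => // -[]; move=> y By.
  apply: xeU; rewrite [e]splitr.
  apply: (@ball_triangle _ _ (c (q1, q2, q3))).
    by apply: ball_sym; apply: le_ball xB; exact: ltW.
  by apply: le_ball By; exact: ltW.
apply: countable_bigcupT_measurable => // -[p n].
case: ifP => _; last exact: measurable0.
have -> : B (p, n) = (ball (c p).1.1 n.+1%:R^-1 `*` ball (c p).1.2 n.+1%:R^-1) `*`
   ball (c p).2 n.+1%:R^-1 :> set (mvec3 R).
  by apply/seteqP; split => -[[x y] z] /=; rewrite /B.
have mb (x r : R) : measurable (ball x r : set (measurableTypeR R)).
  by apply: open_measurable; exact: ball_open.
by apply: measurableX; first apply: measurableX; exact: mb.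
Qed.

Lemma continuous_measurable_vec3 F : continuous F ->
  measurable_fun [set: mvec3 R] (F : mvec3 R -> R).
Proof.
move=> /continuousP cF.
apply: (measurability _ (RGenOpens.measurableE R)) => _ [_ [a [b ->] <-]].
by rewrite setTI; apply: measurable_open_vec3; apply: cF; exact: interval_open.
Qed.

Lemma periodic_int F (k : int) j x : periodic F ->
  F (x + (2 * pi * k%:~R) *: basis3 j) = F x.
Proof.
move=> pF.
have pN (n : nat) y : F (y + (2 * pi * n%:R) *: basis3 j) = F y.
  elim: n y => [|n IHn] y; first by rewrite mulr0 scale0r addr0.
  by rewrite -[n.+1%:R]natr1 mulrDr mulr1 scalerDl addrA pF IHn.
case: k => n; first by rewrite pN.
by rewrite NegzE rmorphN/= mulrN scaleNr -[LHS](pN n.+1) subrK.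
Qed.

Lemma continuous_periodic_bounded F : continuous F -> periodic F ->
  exists M, forall x, `|F x| <= M.
Proof.
move=> cF pF.
pose I : set R := `[0, 2 * pi]%classic.
have cI : compact I by exact: segment_compact.
have cK : compact (I `*` I `*` I) by do 2! apply: compact_setX => //.
have [M [_ MF]] : bounded_set (F @` (I `*` I `*` I)).
  apply: compact_bounded; apply: continuous_compact => //.
  exact: continuous_subspaceT.
exists (M + 1) => x.
pose r (t : R) := t + 2 * pi * (- Num.floor (t / (2 * pi)))%:~R.
have pi2 : 0 < 2 * pi :> R by rewrite mulr_gt0 ?pi_gt0.
have rI t : I (r t).
  rewrite /I /= in_itv/= /r rmorphN/= mulrN.
  have := floor_le (t / (2 * pi)); have := floorD1_gt (t / (2 * pi)).
  rewrite rmorphD/= ler_pdivlMr// ltr_pdivrMr//.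
  by move: (_%:~R) => k; rewrite mulrC mulrDr mulr1 [k * _]mulrC => ? ?; lra.
have -> : F x = F (r x.1.1, r x.1.2, r x.2).
  rewrite -(periodic_int _ (- Num.floor (x.1.1 / (2 * pi))) ord0 _ pF).
  rewrite -(periodic_int _ (- Num.floor (x.1.2 / (2 * pi))) 1 _ pF).
  rewrite -(periodic_int _ (- Num.floor (x.2 / (2 * pi))) 2 _ pF).
  by congr F; congr (_, _, _) => /=; rewrite /r /= /GRing.scale/= ?mulr1 ?mulr0 ?addr0.
apply: MF; first by rewrite ltrDl.
exists (r x.1.1, r x.1.2, r x.2) => //.
by split; [split|]; exact: rI.
Qed.

Lemma torus_measureT : T3 setT = ((2 * pi) ^+ 3)%:E.
Proof.
have cT : C setT = (2 * pi)%:E.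
  rewrite /circle_measure /= /mfrestr /mrestr setTI lebesgue_measure_itv/= lte_fin.
  by rewrite mulr_gt0 ?pi_gt0// oppr0 adde0.
have cTT : (C \x C)%E setT = ((2 * pi) * (2 * pi))%:E.
  rewrite -setXTT; apply: (etrans (product_measure1E _ _ _ _)) => //.
  by rewrite EFinM; congr (_ * _)%E; exact: cT.
rewrite -setXTT; apply: (etrans (product_measure1E _ _ _ _)) => //.
by rewrite !exprSr expr0 mul1r EFinM; congr (_ * _)%E; [exact: cTT|exact: cT].
Qed.

Lemma integrable_bounded F M : measurable_fun [set: mvec3 R] (F : mvec3 R -> R) ->
  (forall x, `|F x| <= M) -> T3.-integrable setT (EFin \o F).
Proof.
move=> mF FM; apply: measurable_bounded_integrable => //.
  by rewrite torus_measureT ltry.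
by exists M; split; [exact: num_real|move=> y My x _ /=; exact: le_trans (FM x) (ltW My)].
Qed.

(** The complement of the half-open cell is null for [circle_measure], and the endpoint added to the
    cell is Lebesgue-null. The closed interval is the one to which the fundamental theorem of
    calculus applies. *)
Lemma integral_circle (g : R -> R) : continuous g ->
  (\int[C]_x (g x)%:E = \int[lebesgue_measure]_(x in `[0%R, (2 * pi)%R]) (g x)%:E)%E.
Proof.
move=> cg; have mg := continuous_measurable_fun cg.
have mE : measurable_fun setT (EFin \o g) by exact/measurable_EFinP.
rewrite -integral_itv_bndo_bndc; last exact: measurable_funS mE.
set I := [set` _].
have mI : measurable I by exact: measurable_itv.
rewrite -(setvU I) integral_setU_EFin//; last 3 first.
- exact: measurableC.
- by rewrite setvU; exact: mg.
- by rewrite /disj_set setICl.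
rewrite null_set_integral ?add0e//; last 3 first.
- exact: measurableC.
- exact: measurable_funS mE.
- by rewrite /circle_measure /= /mfrestr /mrestr setICl measure0.
apply: eq_measure_integral => A mA AI.
by rewrite /circle_measure /= /mfrestr /mrestr setIidl.
Qed.

Lemma integral_circle_derive1 (g : R -> R) : (forall x, derivable g x 1) ->
  continuous (derive1 g) -> g (2 * pi) = g 0 -> (\int[C]_x (derive1 g x)%:E = 0)%E.
Proof.
move=> dg cg' gpi; rewrite integral_circle//.
have cg : continuous g.
  by move=> x; apply/differentiable_continuous/derivable1_diffP.
rewrite (@continuous_FTC2 _ _ g)//.
- by rewrite gpi subee.
- by rewrite mulr_gt0 ?pi_gt0.
- exact: continuous_subspaceT.
- split=> //.
  + by apply: cvg_at_right_filter; exact: cg.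
  + by apply: cvg_at_left_filter; exact: cg.
Qed.

End TorusCalculus.

(** * Fubini's theorem for three factors *)

Section TripleProduct.
Local Open Scope ereal_scope.
Context {d} {T : measurableType d} {R : realType}.
Variable m : {finite_measure set T -> \bar R}.

(* The library's product measure has no canonical structure of finite measure,
   which Fubini's theorem needs on the first two factors of [torus_measure]. *)
Definition square_measure : set (T * T)%type -> \bar R := (m \x m).

HB.instance Definition _ := Measure.copy square_measure (m \x m).

Let square_fin : fin_num_fun square_measure.
Proof.
move=> U mU; rewrite ge0_fin_numE ?measure_ge0//.
apply: (@le_lt_trans _ _ (square_measure setT)); first by rewrite le_measure ?inE.
have -> : square_measure setT = m setT * m setT.
  by rewrite -setXTT; exact: product_measure1E.
by rewrite -ge0_fin_numE ?mule_ge0// fin_numM// fin_num_measure.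
Qed.
HB.instance Definition _ := Measure_isFinite.Build _ _ _ square_measure square_fin.

(** Fubini is available in either order on both nested products, so the vanishing one-dimensional
    integral can be made the innermost one, whichever variable it concerns. *)
Lemma integral_prod3_eq0 (g : T * T * T -> R) :
  (square_measure \x m).-integrable setT (EFin \o g) ->
  (forall z, square_measure.-integrable setT (EFin \o (fun x => g (x, z)))) ->
  [\/ forall y z, \int[m]_x (g (x, y, z))%:E = 0,
      forall x z, \int[m]_y (g (x, y, z))%:E = 0 |
      forall x y, \int[m]_z (g (x, y, z))%:E = 0] ->
  \int[square_measure \x m]_x (g x)%:E = 0.
Proof.
move=> ig i2.
case=> g0.
- apply: (etrans (esym (integral21_prod_meas1 ig))); apply: integral0_eq => z _.
  apply: (etrans (esym (integral21_prod_meas1 (i2 z)))).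
  by apply: integral0_eq => y _; exact: g0.
- apply: (etrans (esym (integral21_prod_meas1 ig))); apply: integral0_eq => z _.
  apply: (etrans (esym (integral12_prod_meas1 (i2 z)))).
  by apply: integral0_eq => x _; exact: g0.
- apply: (etrans (esym (integral12_prod_meas1 ig))); apply: integral0_eq => -[x y] _.
  exact: g0.
Qed.
End TripleProduct.

Section Coordinates.
Context {R : realType}.
Implicit Types x y : vec3 R.

Lemma crdD x y i : crd (x + y) i = crd x i + crd y i.
Proof. by case: i => [[|[|[|//]]] ?]. Qed.

Lemma crdZ (a : R) x i : crd (a *: x) i = a * crd x i.
Proof. by case: i => [[|[|[|//]]] ?]. Qed.

Lemma crd_inj x y : (forall i, crd x i = crd y i) -> x = y.
Proof.
move=> E; have [] := (E 0, E 1, E 2).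
by case: x y {E} => [[x0 x1] x2] [[y0 y1] y2]; rewrite /crd/= => -[-> ->] ->.
Qed.

Lemma crd_basis3 i j : crd (basis3 j : vec3 R) i = (i == j)%:R.
Proof. by case: i j => [[|[|[|//]]] ?] [[|[|[|//]]] ?]. Qed.

End Coordinates.

Section TorusCalculus.
Context {R : realType}.
Implicit Types (F g : vec3 R -> R).
Local Notation T3 := (torus_measure R).
Local Notation C := (circle_measure R).

Lemma derivable_line F (v x : vec3 R) (f := fun t : R => F (t *: v + x)) t :
  derivable F (t *: v + x) v -> derivable f t 1 /\ derive1 f t = 'D_v F (t *: v + x).
Proof.
have E : (fun h : R => h^-1 *: ((f \o shift t) (h *: (1 : R)) - f t)) =
    (fun h => h^-1 *: ((F \o shift (t *: v + x)) (h *: v) - F (t *: v + x))).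
  by apply/funext => h; rewrite /f /shift/= [h *: 1]mulr1 scalerDl addrA.
by move=> dF; split; [rewrite /derivable E|rewrite derive1E /derive E].
Qed.

Lemma integral_circle_derive F (v x : vec3 R) : (forall y, derivable F y v) ->
  continuous ('D_v F) -> (forall y, F (y + (2 * pi) *: v) = F y) ->
  (\int[C]_t ('D_v F (t *: v + x))%:E = 0)%E.
Proof.
move=> dF cDF pF; pose f (t : R) := F (t *: v + x).
have D1 t : derive1 f t = 'D_v F (t *: v + x) by apply: (derivable_line _ _ _ _ (dF _)).2.
have cf : continuous (derive1 f).
  rewrite (funext D1) => t.
  apply: (@continuous_comp _ _ _ (fun t : R => t *: v + x) ('D_v F)); last exact: cDF.
  by apply: cvgD; [apply: cvgZr_tmp; exact: cvg_id|exact: cvg_cst].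
transitivity (\int[C]_t (derive1 f t)%:E)%E.
  by apply: eq_integral => t _; rewrite D1.
have df t : derivable f t 1 by apply: (derivable_line _ _ _ _ (dF _)).1.
have fpi : f (2 * pi) = f 0 by rewrite /f addrC pF scale0r add0r.
have := integral_circle_derive1 f df cf fpi.
by [].
Qed.

Lemma periodic_derive F v : periodic F -> periodic ('D_v F).
Proof.
move=> pF x j; rewrite /derive/=.
by under eq_fun do rewrite /shift/= addrA !pF.
Qed.

(** Applied to products, this is integration by parts on the torus. Along each line of direction [j]
    the integrand is the derivative of a periodic function of one variable. *)
Lemma Rintegral_derive F j : periodic F -> (forall x, derivable F x (basis3 j)) ->
  continuous ('D_(basis3 j) F) -> \int[T3]_x 'D_(basis3 j) F x = 0.
Proof.
move=> pF dF cDF; set g := 'D_(basis3 j) F.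
have mg : measurable_fun [set: mvec3 R] (g : mvec3 R -> R).
  exact: continuous_measurable_vec3.
have [M gM] := continuous_periodic_bounded _ cDF (periodic_derive _ _ pF).
have ig := integrable_bounded _ _ mg gM.
have slice x : (\int[C]_t (g (t *: basis3 j + x))%:E = 0)%E.
  by apply: integral_circle_derive => // y; exact: pF.
rewrite /Rintegral (_ : (\int[T3]_x _)%E = 0)%E//.
have shift_coord (t : R) (y z : vec3 R) :
    (forall i, crd y i = crd z i + t * crd (basis3 j) i) -> g y = g (t *: basis3 j + z).
  by move=> E; congr g; apply: crd_inj => i; rewrite E crdD crdZ addrC.
have i2 z : (square_measure C).-integrable setT (EFin \o (fun x => g (x, z))).
  apply: measurable_bounded_integrable => //.
  - by rewrite -ge0_fin_numE ?fin_num_measure.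
  - by apply: measurableT_comp => //; exact: pair2_measurable.
  - by exists M; split; [exact: num_real|move=> y My x _ /=; exact: le_trans (gM _) (ltW My)].
apply: (integral_prod3_eq0 C g ig i2).
(* With the [j]-th coordinate of the base point set to 0, the line [t *: basis3 j + _] is the slice
   over which Fubini integrates. *)
case: j @g {dF cDF mg gM ig i2} shift_coord slice => -[|[|[|//]]] j3 g shift_coord slice.
- apply: Or31 => y z; rewrite -[RHS](slice (0, y, z)); apply: eq_integral => x _.
  congr _%:E; apply: shift_coord => -[[|[|[|//]]] ?]; rewrite /crd/=; ring.
- apply: Or32 => y z; rewrite -[RHS](slice (y, 0, z)); apply: eq_integral => x _.
  congr _%:E; apply: shift_coord => -[[|[|[|//]]] ?]; rewrite /crd/=; ring.
- apply: Or33 => y z; rewrite -[RHS](slice (y, z, 0)); apply: eq_integral => x _.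
  congr _%:E; apply: shift_coord => -[[|[|[|//]]] ?]; rewrite /crd/=; ring.
Qed.

End TorusCalculus.

Section DotProduct.
Context {R : realType}.
Implicit Types w x y : vec3 R.

Lemma dotDr w x y : dot w (x + y) = dot w x + dot w y.
Proof. by rewrite /dot -big_split; apply: eq_bigr => i _; rewrite crdD mulrDr. Qed.

Lemma dotZr w (a : R) x : dot w (a *: x) = a * dot w x.
Proof. by rewrite /dot mulr_sumr; apply: eq_bigr => i _; rewrite crdZ mulrCA. Qed.

Lemma dotC x y : dot x y = dot y x.
Proof. by apply: eq_bigr => i _; rewrite mulrC. Qed.

Lemma dotDl w x y : dot (x + y) w = dot x w + dot y w.
Proof. by rewrite dotC dotDr !(dotC w). Qed.

Lemma dotNl w x : dot (- x) w = - dot x w.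
Proof. by rewrite -scaleN1r dotC dotZr mulN1r dotC. Qed.

Lemma dot_basis3 w j : dot w (basis3 j) = crd w j.
Proof.
rewrite /dot (bigD1 j)//= crd_basis3 eqxx mulr1 big1 ?addr0// => i ij.
by rewrite crd_basis3 (negbTE ij) mulr0.
Qed.

Lemma continuous_dot w : continuous (dot w).
Proof.
have E : dot w = fun x => crd w 0 * x.1.1 + crd w 1 * x.1.2 + crd w 2 * x.2.
  by apply/funext => x; rewrite /dot !big_ord_recl big_ord0 addr0 addrA.
rewrite E => x; apply: cvgD; first apply: cvgD; apply: cvgMl_tmp.
- by apply: (@cvg_comp _ _ _ fst fst); [exact: cvg_fst|exact: cvg_fst].
- by apply: (@cvg_comp _ _ _ fst snd); [exact: cvg_fst|exact: cvg_snd].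
- exact: cvg_snd.
Qed.

Lemma vec_of_intD (k l : int * int * int) :
  vec_of_int (k + l) = vec_of_int k + vec_of_int l :> vec3 R.
Proof. by rewrite /vec_of_int /= !rmorphD. Qed.

Lemma vec_of_intN (k : int * int * int) : vec_of_int (- k) = - vec_of_int k :> vec3 R.
Proof. by rewrite /vec_of_int /= !rmorphN. Qed.

End DotProduct.

(** * Trigonometric functions with a fixed frequency *)

Section Trigonometric.
Context {R : realType}.
Implicit Types (w x v : vec3 R) (k l : int * int * int).

(** This two-parameter family is stable under directional derivatives, so smoothness becomes an
    induction on the list of directions. *)
Definition trig (a b : R) w x := a * cos (dot w x) + b * sin (dot w x).

Lemma is_derive_trig a b w x v :
  is_derive x v (trig a b w) (dot w v * trig b (- a) w x).
Proof.
pose f (t : R) := trig a b w (t *: v + x).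
have df (t : R) : is_derive t (1 : R) f (dot w v * trig b (- a) w (t *: v + x)).
  have fE : f = fun t => a * cos (t * dot w v + dot w x) + b * sin (t * dot w v + dot w x).
    by apply/funext => s; rewrite /f /trig dotDr dotZr.
  rewrite fE; apply: is_derive_eq.
  rewrite /trig dotDr dotZr /GRing.scale/= !mulr1 !addr0; ring.
have [df0 D0] := df 0.
have dx : derivable (trig a b w) x v by apply/derivable1P.
apply: DeriveDef => //.
have [_ ] := @derivable_line R (trig a b w) v x 0 ltac:(by rewrite scale0r add0r).
by rewrite derive1E D0 scale0r add0r => ->.
Qed.

Lemma derive_trig a b w v :
  'D_v (trig a b w) = trig (dot w v * b) (- (dot w v * a)) w.
Proof.
apply/funext => x; have [_ ->] := is_derive_trig a b w x v.
by rewrite /trig; ring.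
Qed.

Lemma continuous_trig a b w : continuous (trig a b w).
Proof.
move=> x; apply: cvgD; apply: cvgMl_tmp.
- by apply: (@continuous_comp _ _ _ (dot w) cos); [exact: continuous_dot|exact: continuous_cos].
- by apply: (@continuous_comp _ _ _ (dot w) sin); [exact: continuous_dot|exact: continuous_sin].
Qed.

Lemma smooth_trig a b w : smooth (trig a b w).
Proof.
move=> s; have [a' [b' ->]] : exists a' b', iter_derive s (trig a b w) = trig a' b' w.
  elim: s => [|v s [a' [b' IHs]]]; first by exists a, b.
  by exists (dot w v * b'), (- (dot w v * a')); rewrite /= IHs derive_trig.
by split; [exact: continuous_trig|move=> x v; have [] := is_derive_trig a' b' w x v].
Qed.

Definition cosk k x := cos (dot (vec_of_int k) x).
Definition sink k x := sin (dot (vec_of_int k) x).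

Lemma coskE k : cosk k = trig 1 0 (vec_of_int k).
Proof. by apply/funext => x; rewrite /trig mul1r mul0r addr0. Qed.

Lemma sinkE k : sink k = trig 0 1 (vec_of_int k).
Proof. by apply/funext => x; rewrite /trig mul1r mul0r add0r. Qed.

Lemma coskD k l x : cosk (k + l) x = cosk k x * cosk l x - sink k x * sink l x.
Proof. by rewrite /cosk /sink vec_of_intD dotDl cosD. Qed.

Lemma sinkD k l x : sink (k + l) x = sink k x * cosk l x + cosk k x * sink l x.
Proof. by rewrite /cosk /sink vec_of_intD dotDl sinD. Qed.

Lemma coskN k x : cosk (- k) x = cosk k x.
Proof. by rewrite /cosk vec_of_intN dotNl cosN. Qed.

Lemma sinkN k x : sink (- k) x = - sink k x.
Proof. by rewrite /sink vec_of_intN dotNl sinN. Qed.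

Lemma cosk0 x : cosk 0 x = 1.
Proof. by rewrite /cosk /dot big1 ?cos0// => i _; case: i => [[|[|[|//]]] ?]; rewrite /crd/= mul0r. Qed.

Lemma sink0 x : sink 0 x = 0.
Proof. by rewrite /sink /dot big1 ?sin0// => i _; case: i => [[|[|[|//]]] ?]; rewrite /crd/= mul0r. Qed.

Lemma cosk_le1 k x : `|cosk k x| <= 1. Proof. exact: cos_max. Qed.

Lemma sink_le1 k x : `|sink k x| <= 1. Proof. exact: sin_max. Qed.

Lemma periodic_cosk k : periodic (cosk k) /\ periodic (sink k).
Proof.
pose kj (j : 'I_3) : int := [:: k.1.1; k.1.2; k.2]`_(val j).
have kjE (j : 'I_3) : crd (vec_of_int k) j = (kj j)%:~R :> R.
  by case: j => [[|[|[|//]]] ?].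
have P x j : dot (vec_of_int k) (x + (2 * pi) *: basis3 j)
   = dot (vec_of_int k) x + (pi *+ 2) *~ kj j.
  by rewrite dotDr dotZr dot_basis3 kjE mulrzr mulr2n; congr (_ + _ *~ _); ring.
have [cp sp] : (forall t (m : int), cos (t + (pi *+ 2) *~ m) = cos t :> R) /\
               (forall t (m : int), sin (t + (pi *+ 2) *~ m) = sin t :> R).
  split=> t [] n.
  - by rewrite -pmulrn (periodicn (@cosD2pi R)).
  - by rewrite NegzE mulrNz -[LHS](periodicn (@cosD2pi R) n.+1) -pmulrn subrK.
  - by rewrite -pmulrn (periodicn (@sinD2pi R)).
  - by rewrite NegzE mulrNz -[LHS](periodicn (@sinD2pi R) n.+1) -pmulrn subrK.
by split=> x j; rewrite /cosk /sink P.
Qed.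

End Trigonometric.

(** * Orthogonality relations and Parseval's identity *)

Section TorusIntegral.
Context {R : realType}.
Implicit Types (f g : vec3 R -> R) (k l : int * int * int).
Local Notation T3 := (torus_measure R).
Local Notation V := ((2 * pi) ^+ 3 : R).

Definition torus_integrable f := T3.-integrable setT (EFin \o f).

Lemma tvol_gt0 : 0 < V.
Proof. by rewrite exprn_gt0// mulr_gt0// pi_gt0. Qed.

Lemma tintegrable_bounded f M : measurable_fun [set: mvec3 R] (f : mvec3 R -> R) ->
  (forall x, `|f x| <= M) -> torus_integrable f.
Proof. exact: integrable_bounded. Qed.

Lemma tintegrableZ (a : R) f : torus_integrable f -> torus_integrable (fun x => a * f x).
Proof. by move=> intf; apply: eq_integrable (integrableZl _ a intf) => //. Qed.

Lemma tintegrableD f g : torus_integrable f -> torus_integrable g ->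
  torus_integrable (fun x => f x + g x).
Proof. by move=> intf intg; apply: eq_integrable (integrableD _ intf intg) => //. Qed.

Lemma tintegrableB f g : torus_integrable f -> torus_integrable g ->
  torus_integrable (fun x => f x - g x).
Proof. by move=> intf intg; apply: eq_integrable (integrableB _ intf intg) => //. Qed.

Lemma tintegralZ (a : R) f : torus_integrable f ->
  \int[T3]_x (a * f x) = a * \int[T3]_x f x.
Proof. by move=> intf; exact: RintegralZl. Qed.

Lemma tintegralD f g : torus_integrable f -> torus_integrable g ->
  \int[T3]_x (f x + g x) = \int[T3]_x f x + \int[T3]_x g x.
Proof. by move=> *; exact: RintegralD. Qed.

Lemma tintegralB f g : torus_integrable f -> torus_integrable g ->
  \int[T3]_x (f x - g x) = \int[T3]_x f x - \int[T3]_x g x.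
Proof. by move=> *; exact: RintegralB. Qed.

Lemma tintegral0 : \int[T3]_x (0 : R) = 0.
Proof. by rewrite /Rintegral integral0. Qed.

Lemma tintegral_ge0 f : (forall x, 0 <= f x) -> 0 <= \int[T3]_x f x.
Proof. by move=> f0; apply: Rintegral_ge0. Qed.

Lemma le_tintegral f g : torus_integrable f -> torus_integrable g ->
  (forall x, f x <= g x) -> \int[T3]_x f x <= \int[T3]_x g x.
Proof. by move=> *; apply: le_Rintegral. Qed.

Lemma tintegrable_sum (I : Type) (s : seq I) (F : I -> vec3 R -> R) :
  (forall i, torus_integrable (F i)) -> torus_integrable (fun x => \sum_(i <- s) F i x).
Proof.
move=> iF; elim: s => [|i s IHs].
  by apply: eq_integrable (integrable0 _ _) => // x _; rewrite /= big_nil.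
by apply: eq_integrable (tintegrableD _ _ (iF i) IHs) => // x _; rewrite /= big_cons.
Qed.

Lemma tintegral_sum (I : Type) (s : seq I) (F : I -> vec3 R -> R) :
  (forall i, torus_integrable (F i)) ->
  \int[T3]_x (\sum_(i <- s) F i x) = \sum_(i <- s) \int[T3]_x F i x.
Proof.
move=> iF; elim: s => [|i s IHs].
  by under eq_Rintegral do rewrite big_nil; rewrite tintegral0 big_nil.
under eq_Rintegral do rewrite big_cons.
by rewrite tintegralD ?IHs ?big_cons//; exact: tintegrable_sum.
Qed.

Lemma measurable_trig (a b : R) w : measurable_fun [set: mvec3 R] (trig a b w : mvec3 R -> R).
Proof. by apply: continuous_measurable_vec3; exact: continuous_trig. Qed.

Lemma measurable_cosk k : measurable_fun [set: mvec3 R] (cosk k : mvec3 R -> R).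
Proof. by rewrite coskE; exact: measurable_trig. Qed.

Lemma measurable_sink k : measurable_fun [set: mvec3 R] (sink k : mvec3 R -> R).
Proof. by rewrite sinkE; exact: measurable_trig. Qed.

Lemma tintegrable_cosk k : torus_integrable (cosk k).
Proof. exact: tintegrable_bounded (measurable_cosk k) (cosk_le1 k). Qed.

Lemma tintegrable_sink k : torus_integrable (sink k).
Proof. exact: tintegrable_bounded (measurable_sink k) (sink_le1 k). Qed.

(** For [k != 0] some coordinate of [k] is nonzero, and in that direction the function is the
    derivative of a member of the same [trig] family, so that its integral is 0. *)
Lemma tintegral_cosk_sink k :
  \int[T3]_x cosk k x = V *+ (k == 0) /\ \int[T3]_x sink k x = 0.
Proof.
have [->|k0] := eqVneq k 0.
  split; last by under eq_Rintegral do rewrite sink0; exact: tintegral0.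
  under eq_Rintegral do rewrite cosk0.
  by rewrite Rintegral_cst// torus_measureT mul1r.
have [j kj] : exists j, crd (vec_of_int k) j != 0 :> R.
  apply: contrapT => /forallNP kj; case/negP: k0.
  have kj0 j : crd (vec_of_int k) j = 0 :> R by apply/eqP; apply: contrapT => /negP; exact: kj.
  move: (kj0 0) (kj0 1) (kj0 2) => /eqP + /eqP + /eqP; case: k {kj kj0} => [[a b] c].
  by rewrite /crd/= !intr_eq0 => /eqP -> /eqP -> /eqP ->.
have D (a b : R) : trig a b (vec_of_int k) = 
    'D_(basis3 j) (trig (- b / crd (vec_of_int k) j) (a / crd (vec_of_int k) j) (vec_of_int k)).
  by rewrite derive_trig dot_basis3; congr trig; field; exact: kj.
have z (a b : R) : \int[T3]_x trig a b (vec_of_int k) x = 0.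
  rewrite D Rintegral_derive//.
  - move=> x i; rewrite /trig -/(cosk k x) -/(sink k x).
    by rewrite -/(cosk k _) -/(sink k _) (periodic_cosk k).1 (periodic_cosk k).2.
  - by move=> x; have [] := is_derive_trig (- b / crd (vec_of_int k) j) (a / crd (vec_of_int k) j) (vec_of_int k) x (basis3 j).
  - by rewrite -D; exact: continuous_trig.
by rewrite coskE sinkE !z.
Qed.

(** The two sums are the real and imaginary parts of the exponential sum with coefficients [a i]
    minus sqrt(-1) times [b i]. In the squared modulus only the differences [K i - K j] occur, so
    opposite frequencies may both be present; with the first square alone they would interfere. *)
Lemma trig_parseval (I : eqType) (s : seq I) (K : I -> int * int * int) (a b : I -> R) :
  uniq s -> {in s &, injective K} ->
  \int[T3]_x ((\sum_(i <- s) (a i * cosk (K i) x + b i * sink (K i) x)) ^+ 2 +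
              (\sum_(i <- s) (a i * sink (K i) x - b i * cosk (K i) x)) ^+ 2)
  = V * \sum_(i <- s) (a i ^+ 2 + b i ^+ 2).
Proof.
move=> us Ki.
transitivity (\int[T3]_x \sum_(i <- s) \sum_(j <- s)
  ((a i * a j + b i * b j) * cosk (K i - K j) x + (b i * a j - a i * b j) * sink (K i - K j) x)).
  apply: eq_Rintegral => x _; rewrite !expr2 !big_distrlr -big_split/=.
  apply: eq_bigr => i _; rewrite -big_split/=; apply: eq_bigr => j _.
  by rewrite coskD sinkD coskN sinkN; ring.
have iF i j : torus_integrable (fun x => (a i * a j + b i * b j) * cosk (K i - K j) x
    + (b i * a j - a i * b j) * sink (K i - K j) x).
  apply: tintegrableD; apply: tintegrableZ; first exact: tintegrable_cosk.
  exact: tintegrable_sink.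
rewrite tintegral_sum => [|i]; last exact: tintegrable_sum.
rewrite mulr_sumr big_seq [RHS]big_seq; apply: eq_bigr => i si.
rewrite tintegral_sum// (bigD1_seq i)//= big1_seq ?addr0 => [|j /andP[ji sj]].
  rewrite subrr; under eq_Rintegral do rewrite cosk0 sink0 mulr0 addr0.
  by rewrite Rintegral_cst// torus_measureT/=; ring.
have ij : K i - K j != 0.
  by apply: contra ji; rewrite subr_eq0 => /eqP/Ki ->.
have [cI sI] := tintegral_cosk_sink (K i - K j).
rewrite tintegralD ?tintegralZ ?cI ?sI ?(negbTE ij) ?mulr0 ?addr0//.
- exact: tintegrable_sink.
- exact: tintegrable_cosk.
- exact/tintegrableZ/tintegrable_cosk.
- exact/tintegrableZ/tintegrable_sink.
Qed.

End TorusIntegral.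

(** * Bessel's inequality and the Fourier coefficients of a weak gradient *)

Section SquareIntegrable.
Context {R : realType}.
Implicit Types (f g : vec3 R -> R) (k l : int * int * int).
Local Notation T3 := (torus_measure R).
Local Notation V := ((2 * pi) ^+ 3 : R).

Definition square_integrable f :=
  measurable_fun [set: mvec3 R] (f : mvec3 R -> R) /\ torus_integrable (fun x => f x ^+ 2).

Lemma L2fun_square_integrable f : L2fun f -> square_integrable f.
Proof.
case=> _ mf f2; split => //; apply/integrableP; split.
  exact/measurable_EFinP/measurable_funX.
under eq_integral do rewrite /= ger0_norm ?sqr_ge0//.
exact: f2.
Qed.

Lemma square_integrable_bounded f M : measurable_fun [set: mvec3 R] (f : mvec3 R -> R) ->
  (forall x, `|f x| <= M) -> square_integrable f.
Proof.
move=> mf fM; split => //; apply: (tintegrable_bounded _ (M ^+ 2)).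
  exact: measurable_funX.
by move=> x; rewrite normrX; apply: lerXn2r; rewrite ?nnegrE// (le_trans _ (fM x)).
Qed.

Lemma square_integrable_cosk k : square_integrable (cosk k).
Proof. exact: square_integrable_bounded (measurable_cosk k) (cosk_le1 k). Qed.

Lemma square_integrable_sink k : square_integrable (sink k).
Proof. exact: square_integrable_bounded (measurable_sink k) (sink_le1 k). Qed.

Lemma tintegrableM f g : square_integrable f -> square_integrable g ->
  torus_integrable (fun x => f x * g x).
Proof.
move=> [mf f2] [mg g2]; apply: le_integrable (tintegrableD _ _ f2 g2) => //.
  exact/measurable_EFinP/measurable_funM.
move=> x _; rewrite lee_fin.
rewrite [leRHS]ger0_norm ?addr_ge0 ?sqr_ge0// ler_norml; apply/andP; split; nra.
Qed.

Lemma square_integrableD f g : square_integrable f -> square_integrable g ->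
  square_integrable (fun x => f x + g x).
Proof.
move=> sf sg; split; first by apply: measurable_funD; [exact: sf.1|exact: sg.1].
have := tintegrableD _ _ (tintegrableD _ _ sf.2 sg.2) (tintegrableZ 2 _ (tintegrableM _ _ sf sg)).
by apply: eq_integrable => // x _ /=; congr _%:E; ring.
Qed.

Lemma square_integrableZ (a : R) f : square_integrable f -> square_integrable (fun x => a * f x).
Proof.
move=> sf; split; first by apply: measurable_funM => //; exact: sf.1.
apply: eq_integrable (tintegrableZ (a ^+ 2) _ sf.2) => // x _ /=.
by rewrite exprMn.
Qed.

Lemma square_integrable_sum (I : Type) (s : seq I) (F : I -> vec3 R -> R) :
  (forall i, square_integrable (F i)) -> square_integrable (fun x => \sum_(i <- s) F i x).
Proof.
move=> iF; elim: s => [|i s IHs].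
  under eq_fun do rewrite big_nil.
  by apply: (square_integrable_bounded _ 0) => // x; rewrite normr0.
under eq_fun do rewrite big_cons.
exact: square_integrableD.
Qed.

(** [P] and [Q] are the real and imaginary parts of the partial Fourier sum of [f] over [s]; the
    inequality is the integral of [(f - P) ^+ 2 + Q ^+ 2] being nonnegative. [Q] does not vanish in
    general because [s] need not be symmetric. *)
Lemma bessel f (s : seq (int * int * int)) : square_integrable f -> uniq s ->
  \sum_(k <- s) ((\int[T3]_x (f x * cosk k x)) ^+ 2 + (\int[T3]_x (f x * sink k x)) ^+ 2)
  <= V * \int[T3]_x (f x ^+ 2).
Proof.
move=> sf us.
pose a k := V^-1 * \int[T3]_x (f x * cosk k x); pose b k := V^-1 * \int[T3]_x (f x * sink k x).
pose P x := \sum_(k <- s) (a k * cosk k x + b k * sink k x).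
pose Q x := \sum_(k <- s) (a k * sink k x - b k * cosk k x).
have V0 := @tvol_gt0 R; have Vn0 := lt0r_neq0 V0.
have Va k : \int[T3]_x (f x * cosk k x) = V * a k by rewrite mulVKf.
have Vb k : \int[T3]_x (f x * sink k x) = V * b k by rewrite mulVKf.
have st (c d : R) k : square_integrable (fun x => c * cosk k x + d * sink k x).
  by apply: square_integrableD; apply: square_integrableZ;
    [exact: square_integrable_cosk|exact: square_integrable_sink].
have sP : square_integrable P by apply: square_integrable_sum.
have sQ : square_integrable Q.
  apply: square_integrable_sum => k.
  by under eq_fun do rewrite addrC -mulNr; exact: st.
have PQ : \int[T3]_x (P x ^+ 2 + Q x ^+ 2) = V * \sum_(k <- s) (a k ^+ 2 + b k ^+ 2).
  by apply: (trig_parseval _ s id a b us) => k l _ _.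
have fP : \int[T3]_x (f x * P x) = V * \sum_(k <- s) (a k ^+ 2 + b k ^+ 2).
  under eq_Rintegral do rewrite /P mulr_sumr.
  rewrite tintegral_sum => [|k]; last by apply: tintegrableM.
  rewrite mulr_sumr; apply: eq_bigr => k _.
  transitivity (\int[T3]_x (a k * (f x * cosk k x) + b k * (f x * sink k x))).
    by apply: eq_Rintegral => x _; ring.
  have ic := tintegrableM _ _ sf (square_integrable_cosk k).
  have is_ := tintegrableM _ _ sf (square_integrable_sink k).
  rewrite tintegralD ?tintegralZ//; [|exact: tintegrableZ|exact: tintegrableZ].
  by rewrite Va Vb; ring.
have : 0 <= \int[T3]_x ((f x ^+ 2 - 2 * (f x * P x)) + (P x ^+ 2 + Q x ^+ 2)).
  apply: tintegral_ge0 => x; rewrite addrA addr_ge0 ?sqr_ge0//.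
  by have := sqr_ge0 (f x - P x); congr (0 <= _); ring.
have ifP := tintegrableZ 2 _ (tintegrableM _ _ sf sP).
rewrite tintegralD ?PQ; [|exact: tintegrableB sf.2 ifP|exact: tintegrableD sP.2 sQ.2].
rewrite tintegralB ?tintegralZ ?fP//; [|exact: tintegrableM|exact: sf.2].
set S := \sum_(k <- s) (a k ^+ 2 + b k ^+ 2).
rewrite (_ : \sum_(k <- s) _ = V * (V * S)); first by rewrite ler_pM2l//; lra.
rewrite mulrA /S mulr_sumr; apply: eq_bigr => k _.
by rewrite Va Vb; ring.
Qed.

(** The rule that differentiation multiplies the [k]-th Fourier coefficient by sqrt(-1) times [k_j],
    in real form; [cosk k] and [sink k] are themselves admissible test functions. *)
Lemma weak_gradient_coef (v : vfield) (G : 'I_3 -> vfield) i j k :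
  square_integrable (v i) -> weak_gradient v G ->
  crd (vec_of_int k) j * \int[T3]_x (v i x * sink k x) = \int[T3]_x (G i j x * cosk k x) /\
  crd (vec_of_int k) j * \int[T3]_x (v i x * cosk k x) = - \int[T3]_x (G i j x * sink k x).
Proof.
move=> sv vG; have [_ wG] := vG i j; have [pc ps] := @periodic_cosk R k.
set c := crd _ _.
have Dcos (x : vec3 R) : 'D_(basis3 j) (cosk k) x = - c * sink k x.
  rewrite coskE; have [_ ->] := is_derive_trig 1 0 (vec_of_int k) x (basis3 j).
  by rewrite dot_basis3 sinkE /trig -/c; ring.
have Dsin (x : vec3 R) : 'D_(basis3 j) (sink k) x = c * cosk k x.
  rewrite sinkE; have [_ ->] := is_derive_trig 0 1 (vec_of_int k) x (basis3 j).
  by rewrite dot_basis3 coskE /trig -/c; ring.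
have icos := tintegrableM _ _ sv (square_integrable_cosk k).
have isin := tintegrableM _ _ sv (square_integrable_sink k).
have scos : smooth (cosk k : vec3 R -> R) by rewrite coskE; exact: smooth_trig.
have ssin : smooth (sink k : vec3 R -> R) by rewrite sinkE; exact: smooth_trig.
split.
- have <- : - (\int[T3]_x (v i x * 'D_(basis3 j) (cosk k) x)) =
      \int[T3]_x (G i j x * cosk k x) by rewrite (wG _ scos pc) opprK.
  rewrite -[LHS]opprK -mulNr -tintegralZ//; congr (- _).
  by apply: eq_Rintegral => x _; rewrite Dcos; ring.
- rewrite -(wG _ ssin ps) -tintegralZ//.
  by apply: eq_Rintegral => x _; rewrite Dsin; ring.
Qed.

End SquareIntegrable.

(** * Series of functions with geometrically decreasing L^2 norms *)

Section WeightedSeries.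
Context {R : realType}.
Implicit Types (a : R^nat) (rho H : R).

Lemma geometric_sum_le rho n : 0 < rho < 1 -> \sum_(0 <= p < n) rho ^+ p <= (1 - rho)^-1.
Proof.
move=> /andP[r0 r1]; have r10 : 0 < 1 - rho by rewrite subr_gt0.
rewrite -[leRHS]mul1r ler_pdivlMr//.
have -> : (\sum_(0 <= p < n) rho ^+ p) * (1 - rho) = 1 - rho ^+ n.
  elim: n => [|n IHn]; first by rewrite big_nil expr0 mul0r subrr.
  by rewrite big_nat_recr//= mulrDl IHn exprSr; ring.
by rewrite lerBlDr lerDl exprn_ge0// ltW.
Qed.

(** Cauchy-Schwarz for the splitting of [a p] into rho^(p/2) and rho^(-p/2) [a p], by induction on
    [n] so that no square roots appear. *)
Lemma weighted_sum_sqr rho a n : 0 < rho ->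
  (\sum_(0 <= p < n) a p) ^+ 2 <=
  (\sum_(0 <= p < n) rho ^+ p) * (\sum_(0 <= p < n) rho ^- p * a p ^+ 2).
Proof.
move=> r0; elim: n => [|n IHn]; first by rewrite !big_nil expr0n mul0r.
rewrite !big_nat_recr//=.
set S := \sum_(0 <= p < n) a p in IHn *; set A := \sum_(0 <= p < n) rho ^+ p in IHn *.
set B := \sum_(0 <= p < n) _ in IHn *.
have A0 : 0 <= A by apply: sumr_ge0 => p _; rewrite exprn_ge0// ltW.
have B0 : 0 <= B by apply: sumr_ge0 => p _; rewrite mulr_ge0 ?sqr_ge0// invr_ge0 exprn_ge0// ltW.
have w0 : 0 < rho ^+ n by rewrite exprn_gt0.
set w := rho ^+ n in w0 *; set t := a n.
have wn : w != 0 by rewrite gt_eqF.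
suff : 2 * S * t <= A * (w^-1 * t ^+ 2) + w * B.
  have -> : (A + w) * (B + w^-1 * t ^+ 2) =
    A * B + (A * (w^-1 * t ^+ 2) + w * B) + t ^+ 2 by field.
  move: IHn; nra.
(* [A] vanishes for [n = 0]. When [S != 0], the induction hypothesis forces [A > 0], and the claim
   can be multiplied by [A] and written with squares. *)
have [S0|Sn0] := eqVneq S 0.
  rewrite S0 mulr0 mul0r; apply: addr_ge0; apply: mulr_ge0 => //; last exact: ltW.
  by apply: mulr_ge0; rewrite ?sqr_ge0// invr_ge0 ltW.
have S2 : 0 < S ^+ 2 by rewrite exprn_even_gt0.
have Ap : 0 < A by rewrite lt_neqAle A0 andbT; apply: contraTneq IHn => <-; rewrite mul0r -ltNge.
have h : A * (2 * S * t) <= A * (A * (w^-1 * t ^+ 2) + w * B).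
  have e : A * (A * (w^-1 * t ^+ 2) + w * B) - A * (2 * S * t) =
     w^-1 * (A * t - w * S) ^+ 2 + w * (A * B - S ^+ 2) by field.
  rewrite -subr_ge0 e addr_ge0// mulr_ge0 ?sqr_ge0 ?invr_ge0 ?subr_ge0//; exact: ltW.
by rewrite -(ler_pM2l Ap).
Qed.

(** To be used pointwise, with [H] the value of an integrable function. Absolute convergence rests
    on [|a p| <= rho ^+ p + rho ^- p * a p ^+ 2], the bound on the limit on the weighted
    Cauchy-Schwarz inequality. *)
Lemma weighted_series a rho H : 0 < rho < 1 ->
  (forall n, \sum_(0 <= p < n) rho ^- p * a p ^+ 2 <= H) ->
  [/\ forall n, `|\sum_(0 <= p < n) a p| <= (1 - rho)^-1 + H,
      cvgn (series a) & limn (series a) ^+ 2 <= (1 - rho)^-1 * H].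
Proof.
move=> r01 aH; have /andP[r0 r1] := r01.
have r10 : 0 < 1 - rho by rewrite subr_gt0.
have absa n : \sum_(0 <= p < n) `|a p| <= (1 - rho)^-1 + H.
  apply: le_trans (lerD (geometric_sum_le rho n r01) (aH n)); rewrite -big_split/=.
  apply: ler_sum_nat => p _.
  have w0 : 0 < rho ^+ p by rewrite exprn_gt0.
  rewrite -[X in _ <= _ + _ * X]real_normK ?num_real//.
  set w := rho ^+ p in w0 *; set t := `|a p|.
  have -> : w + w^-1 * t ^+ 2 = w^-1 * (w - t) ^+ 2 + 2 * t by field; rewrite gt_eqF.
  have : 0 <= w^-1 * (w - t) ^+ 2 by rewrite mulr_ge0 ?sqr_ge0// invr_ge0 ltW.
  have : 0 <= t by rewrite normr_ge0.
  lra.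
have ca : cvgn (series a).
  apply: normed_cvg; apply: nondecreasing_is_cvgn.
    by apply: nondecreasing_series => i _ _; exact: normr_ge0.
  by exists ((1 - rho)^-1 + H) => _ [n _ <-]; exact: absa.
split=> //; first by move=> n; rewrite (le_trans (ler_norm_sum _ _ _))// absa.
have c2 : (fun n => (series a n) ^+ 2) @ \oo --> limn (series a) ^+ 2.
  by rewrite expr2; under eq_fun do rewrite expr2; exact: cvgM.
rewrite -(cvg_lim _ c2)//; apply: limr_le; first by apply/cvg_ex; eexists; exact: c2.
apply: nearW => n; apply: le_trans (weighted_sum_sqr rho a n r0) _.
have H0 : 0 <= H by apply: le_trans (aH 0); rewrite big_nil.
rewrite ler_pM ?geometric_sum_le//; first by apply: sumr_ge0 => p _; rewrite exprn_ge0// ltW.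
by apply: sumr_ge0 => p _; rewrite mulr_ge0 ?sqr_ge0// invr_ge0 exprn_ge0// ltW.
Qed.

End WeightedSeries.

Section SquareSummable.
Context d (T : measurableType d) (R : realType).
Variable mu : {measure set T -> \bar R}.

(** The sum is built pointwise. The weight [rho ^- p] spends half of the decay [rho ^+ (2 * p)], so
    [G] is integrable and [(1 - rho)^-1 + G] dominates every partial sum almost everywhere. The
    third conclusion transfers periodicity from the terms to the sum at every point; the fourth
    gives access to its Fourier coefficients. *)
Lemma square_summable_series (f : nat -> T -> R) (rho C : R) : (mu setT < +oo)%E ->
  0 < rho < 1 ->
  (forall p, measurable_fun setT (f p)) ->
  (forall p, (\int[mu]_x ((f p x) ^+ 2)%:E <= (C * rho ^+ (2 * p))%:E)%E) ->
  exists F : T -> R, [/\ measurable_fun setT F,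
    (\int[mu]_x ((F x) ^+ 2)%:E < +oo)%E,
    (forall x y, (forall p, f p x = f p y) -> F x = F y) &
    forall (g : T -> R) (M : R), measurable_fun setT g -> (forall x, `|g x| <= M) ->
      (fun n => \sum_(0 <= p < n) \int[mu]_x (f p x * g x)) @ \oo -->
      \int[mu]_x (F x * g x)].
Proof.
move=> mufin r01 mf fC; have /andP[r0 r1] := r01.
have r10 : 0 < 1 - rho by rewrite subr_gt0.
pose G x := (\sum_(p <oo) (rho ^- p * f p x ^+ 2)%:E)%E.
have w0 p (t : R) : 0 <= rho ^- p * t ^+ 2.
  by rewrite mulr_ge0 ?sqr_ge0// invr_ge0 exprn_ge0// ltW.
have mfp p : measurable_fun setT (fun x => (rho ^- p * f p x ^+ 2)%:E).
  by apply/measurable_EFinP; apply: measurable_funM => //; exact: measurable_funX.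
have mG : measurable_fun setT G by apply: ge0_emeasurable_sum => // p x _ _; rewrite lee_fin.
have G0 x : (0 <= G x)%E by apply: nneseries_ge0 => p _ _; rewrite lee_fin.
have iG : (\int[mu]_x G x <= (C / (1 - rho))%:E)%E.
  rewrite integral_nneseries//; last by move=> p x _; rewrite lee_fin.
  apply: lime_le.
    by apply: is_cvg_nneseries => p _ _; apply: integral_ge0 => x _; rewrite lee_fin.
  apply: nearW => n; apply: (@le_trans _ _ (\sum_(0 <= p < n) (C * rho ^+ p)%:E)%E).
    apply: lee_sum => p _.
    under eq_integral do rewrite EFinM.
    rewrite ge0_integralZl//; last 3 first.
    - by apply/measurable_EFinP; exact: measurable_funX.
    - by move=> x _; rewrite lee_fin sqr_ge0.
    - by rewrite lee_fin invr_ge0 exprn_ge0// ltW.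
    apply: le_trans (lee_wpmul2l _ (fC p)) _; first by rewrite lee_fin invr_ge0 exprn_ge0// ltW.
    rewrite -EFinM lee_fin mul2n -addnn exprD mulrCA mulKf//.
    by rewrite expf_neq0// gt_eqF.
  rewrite sumEFin lee_fin -mulr_sumr.
  have C0 : 0 <= C.
    have := fC 0%N; rewrite muln0 expr0 mulr1; apply: contraLR; rewrite -!ltNge => C0.
    by rewrite (@lt_le_trans _ _ 0%E)// ?lte_fin//; apply: integral_ge0 => x _; rewrite lee_fin sqr_ge0.
  by rewrite ler_wpM2l// geometric_sum_le.
have intG : mu.-integrable setT G.
  apply/integrableP; split => //; under eq_integral do rewrite gee0_abs//.
  by apply: le_lt_trans iG _; rewrite ltry.
(* Truncated so that the series converges at every point. *)
pose h p x := if (G x < +oo)%E then f p x else 0.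
pose H x := fine (G x).
have hH n x : \sum_(0 <= p < n) rho ^- p * h p x ^+ 2 <= H x.
  rewrite /h /H; have [Gx|_] := boolP (G x < +oo)%E; last first.
    by rewrite big1 => [|p _]; [exact: fine_ge0|rewrite expr0n mulr0].
  rewrite -lee_fin fineK ?ge0_fin_numE// -sumEFin; apply: nneseries_lim_ge => p _ _.
  by rewrite lee_fin.
have W x := weighted_series (h ^~ x) rho (H x) r01 (hH ^~ x).
have mh p : measurable_fun setT (h p).
  apply: measurable_fun_ifT => //; exact: measurable_fun_lte.
pose F x := limn (series (h ^~ x)).
have hF x : series (h ^~ x) @ \oo --> F x by have [] := W x.
have mF : measurable_fun setT F.
  apply: (@measurable_fun_cvg _ _ _ _ (fun n x => series (h ^~ x) n)) => //.
  by move=> n; apply: measurable_sum.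
have mH : measurable_fun setT H by exact: measurableT_comp.
have iH : mu.-integrable setT (EFin \o H).
  apply: le_integrable intG => //; first exact/measurable_EFinP.
  move=> x _ /=; rewrite (gee0_abs (G0 x)) ger0_norm ?fine_ge0//.
  rewrite /H; case: (G x) (G0 x) => //= _; exact: leey.
have icst : mu.-integrable setT (EFin \o (fun=> (1 - rho)^-1)).
  apply: measurable_bounded_integrable => //.
  exists `|(1 - rho)^-1|; split; first exact: num_real.
  by move=> y hy x _ /=; exact: ltW.
exists F; split => //.
- have : mu.-integrable setT (EFin \o (fun x => (1 - rho)^-1 * H x)).
    by apply: eq_integrable (integrableZl _ ((1 - rho)^-1) iH).
  move/integrableP => [_]; apply: le_lt_trans; apply: ge0_le_integral => //.
  + by move=> x _; rewrite lee_fin sqr_ge0.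
  + by apply/measurable_EFinP; exact: measurable_funX.
  + apply/measurable_EFinP; apply: measurableT_comp => //; exact: measurable_funM.
  + move=> x _ /=; rewrite lee_fin; have [_ _ h2] := W x.
    by rewrite (le_trans h2)// ler_norm.
- move=> x y fxy; rewrite /F; congr (limn (series _)); apply/funext => p.
  rewrite /h (_ : G x = G y) ?fxy// /G.
  by under eq_eseriesr do rewrite fxy.
- move=> g M mg gM.
  have aeE p : \int[mu]_x (f p x * g x) = \int[mu]_x (h p x * g x).
    congr fine; apply: ae_eq_integral => //.
    + by apply/measurable_EFinP; exact: measurable_funM.
    + by apply/measurable_EFinP; exact: measurable_funM.
    have := integrable_ae measurableT intG; apply: filterS => x /(_ I) Gx _ /=.
    by rewrite /h -ge0_fin_numE// Gx.
  have K0 : 0 <= (1 - rho)^-1 by rewrite invr_ge0 ltW.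
  have [] := @dominated_convergence _ _ _ mu setT measurableT
    (fun n x => (series (h ^~ x) n * g x)%:E) (fun x => (F x * g x)%:E)
    (fun x => (((1 - rho)^-1 + H x) * M)%:E).
  + move=> n; apply/measurable_EFinP; apply: measurable_funM => //; exact: measurable_sum.
  + by apply/measurable_EFinP; exact: measurable_funM.
  + apply: aeW => x _; apply: cvg_EFin; first exact: nearW.
    by apply: cvgM; [exact: hF|exact: cvg_cst].
  + have : mu.-integrable setT (EFin \o (fun x => ((1 - rho)^-1 + H x) * M)).
      by apply: eq_integrable (integrableZr _ M (integrableD _ icst iH)).
    by [].
  + apply: aeW => x n _; rewrite lee_fin normrM ler_pM//.
    by have [+ _ _] := W x; apply.
  move=> iFg _ dct.
  have M0 (x : T) : 0 <= M by apply: le_trans (gM x).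
  have iD : mu.-integrable setT (EFin \o (fun x => 2 * (((1 - rho)^-1 + H x) * M))).
    by apply: eq_integrable
      (integrableZl _ 2 (integrableZr _ M (integrableD _ icst iH))).
  have hg p : mu.-integrable setT (EFin \o (fun x => h p x * g x)).
    apply: le_integrable iD => //; first by apply/measurable_EFinP; exact: measurable_funM.
    move=> x _; rewrite lee_fin normrM mulrA [leRHS]ger0_norm; last first.
      by rewrite mulr_ge0// ?mulr_ge0// ?addr_ge0 ?fine_ge0// (M0 x).
    rewrite ler_pM//; have [hW _ _] := W x.
    (* A term is a difference of two dominated partial sums, hence the factor 2 in [iD]. *)
    have -> : h p x = \sum_(0 <= i < p.+1) h i x - \sum_(0 <= i < p) h i x.
      by rewrite big_nat_recr//= [RHS]addrC addKr.
    by rewrite (le_trans (ler_normB _ _))// mulr2n mulrDl mul1r lerD.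
  have sg n : mu.-integrable setT (EFin \o (fun x => series (h ^~ x) n * g x)).
    elim: n => [|n IHn].
      by apply: eq_integrable (integrable0 _ _) => // x _ /=; rewrite /series/= big_nil mul0r.
    apply: eq_integrable (integrableD _ IHn (hg n)) => // x _ /=.
    by rewrite /series/= big_nat_recr//= mulrDl.
  have E n : \sum_(0 <= p < n) \int[mu]_x (h p x * g x) =
     \int[mu]_x (series (h ^~ x) n * g x).
    elim: n => [|n IHn].
      rewrite big_nil /Rintegral integral0_eq//.
      by move=> x _; rewrite /series/= big_nil mul0r.
    rewrite big_nat_recr//= IHn -RintegralD//.
    by apply: eq_Rintegral => x _; rewrite /series/= big_nat_recr//= mulrDl.
  have -> : (fun n => \sum_(0 <= p < n) \int[mu]_x (f p x * g x)) =
      (fun n => \int[mu]_x (series (h ^~ x) n * g x)).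
    by apply/funext => n; rewrite -E; apply: eq_bigr => p _; exact: aeE.
  apply: fine_cvg; rewrite fineK//.
  exact: integrable_fin_num.
Qed.


End SquareSummable.

(** * Littlewood-Paley blocks *)

Section Cutoff.
Context {R : realType}.
Variables (chi : vec3 R -> R) (hchi : cutoff chi).
Implicit Types (xi : vec3 R) (q : int).

Lemma dot_ge0 (x : vec3 R) : 0 <= dot x x.
Proof. by apply: sumr_ge0 => i _; rewrite -expr2 sqr_ge0. Qed.

Lemma enormZ (a : R) xi : 0 <= a -> enorm (a *: xi) = a * enorm xi.
Proof.
by move=> a0; rewrite /enorm dotZr dotC dotZr mulrA -expr2 sqrtrM ?sqr_ge0// sqrtr_sqr ger0_norm.
Qed.

Lemma enormN xi : enorm (- xi) = enorm xi.
Proof. by rewrite /enorm dotNl dotC dotNl opprK. Qed.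

Lemma crd_le_enorm xi i : `|crd xi i| <= enorm xi.
Proof.
rewrite -sqrtr_sqr /enorm ler_sqrt ?dot_ge0// /dot (bigD1 i)//= -expr2 lerDl.
by apply: sumr_ge0 => j _; rewrite -expr2 sqr_ge0.
Qed.

Lemma chi_one xi : enorm xi <= 3 / 4 -> chi xi = 1. Proof. by case: hchi => _ _ _ + _; apply. Qed.
Lemma chi_zero xi : 1 <= enorm xi -> chi xi = 0. Proof. by case: hchi => _ _ _ _; apply. Qed.

Lemma chi_scaled_zero (c : R) xi : 0 < c -> c <= enorm xi -> chi (c^-1 *: xi) = 0.
Proof.
move=> c0 cx; apply: chi_zero.
have c1 : 0 <= c^-1 by rewrite invr_ge0 ltW.
by rewrite enormZ// ler_pdivlMl// mulr1.
Qed.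

Lemma chi_scaled_one (c : R) xi : 0 < c -> enorm xi <= 3 / 4 * c -> chi (c^-1 *: xi) = 1.
Proof.
move=> c0 cx; apply: chi_one.
have c1 : 0 <= c^-1 by rewrite invr_ge0 ltW.
by rewrite enormZ// ler_pdivrMl// mulrC.
Qed.

Lemma chi_even xi : chi (- xi) = chi xi.
Proof. by case: hchi => _ _ + _ _; apply; rewrite enormN. Qed.

Lemma chi_bounded : exists2 B : R, 0 < B & forall xi, `|chi xi| <= B.
Proof.
case: hchi => sm _ _ _ _.
pose I : set R := `[-1, 1]%classic.
have cI : compact I by exact: segment_compact.
have cK : compact (I `*` I `*` I) by do 2! apply: compact_setX => //.
have [M [_ MF]] : bounded_set (chi @` (I `*` I `*` I)).
  apply: compact_bounded; apply: continuous_compact => //.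
  by apply: continuous_subspaceT; have [] := sm [::].
exists (`|M| + 1) => [|xi]; first by rewrite ltr_wpDl.
have [x1|x1] := leP 1 (enorm xi); first by rewrite chi_zero// normr0 addr_ge0.
have xI i : I (crd xi i).
  by rewrite /I/= in_itv/= -ler_norml (le_trans (crd_le_enorm _ _))// ltW.
apply: MF; first by rewrite (le_lt_trans (ler_norm _))// ltrDl.
by exists xi => //; split; [split|]; [exact: (xI 0)|exact: (xI 1)|exact: (xI 2)].
Qed.

Lemma lambda_gt0 q : 0 < lambda q :> R. Proof. by rewrite /lambda exprz_gt0. Qed.

Lemma lambda_ge2 q q' : q < q' -> 2 * lambda q <= lambda q' :> R.
Proof.
move=> qq'; rewrite /lambda -[X in X * _]expr1z -expfzDr//.
by rewrite ler_weXz2l ?ler1n// addrC lezD1.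
Qed.

Lemma phi_E q xi : q != -1 ->
  phi_ chi q xi = chi ((2 * lambda q)^-1 *: xi) - chi ((lambda q)^-1 *: xi).
Proof. by move=> q1; rewrite /phi_ (negbTE q1) /phi scalerA -invfM mulrC. Qed.

Lemma phi_even q xi : phi_ chi q (- xi) = phi_ chi q xi.
Proof.
have [->|q1] := eqVneq q (-1); first by rewrite /phi_ eqxx chi_even.
by rewrite !phi_E// !scalerN !chi_even.
Qed.

Lemma phi_bounded : exists2 B : R, 0 < B & forall q xi, `|phi_ chi q xi| <= B.
Proof.
have [B B0 hB] := chi_bounded; exists (2 * B); first by rewrite mulr_gt0.
move=> q xi; have [->|q1] := eqVneq q (-1).
  by rewrite /phi_ eqxx (le_trans (hB _))// ler_pMl ?ler1n// ltr1n.
have -> : 2 * B = B + B by ring.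
by rewrite phi_E// (le_trans (ler_normB _ _))// lerD.
Qed.

Lemma phi_large q xi : -1 <= q -> 2 * lambda q <= enorm xi -> phi_ chi q xi = 0.
Proof.
move=> q0 xq; have l0 := lambda_gt0 q; have [q1|q1] := eqVneq q (-1).
  rewrite /phi_ q1 eqxx chi_zero//; move: xq; apply: le_trans.
  by rewrite q1 /lambda exprN1 divff.
by rewrite phi_E// !chi_scaled_zero ?subrr ?mulr_gt0//; lra.
Qed.

Lemma phi_small q xi : 0 <= q -> enorm xi <= 3 / 4 * lambda q -> phi_ chi q xi = 0.
Proof.
move=> q0 xq; have l0 := lambda_gt0 q.
have q1 : q != -1 by apply: contraTneq q0 => ->.
have e0 : 0 <= enorm xi by exact: sqrtr_ge0.
by rewrite phi_E// !chi_scaled_one ?subrr ?mulr_gt0//; lra.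
Qed.

(** On this annulus the inner cutoff is already 0 and the outer one still 1, whatever [chi] is
    between 3/4 and 1. Frequencies placed here are reproduced exactly by one block and, by
    [phi_other], are invisible to all the others. *)
Lemma phi_one q xi : 0 <= q -> lambda q <= enorm xi -> enorm xi <= 3 / 2 * lambda q ->
  phi_ chi q xi = 1.
Proof.
move=> q0 x1 x2; have l0 := lambda_gt0 q.
have q1 : q != -1 by apply: contraTneq q0 => ->.
by rewrite phi_E// chi_scaled_one ?chi_scaled_zero ?subr0 ?mulr_gt0//; lra.
Qed.

Lemma phi_other q q' xi : -1 <= q -> 0 <= q' -> q != q' ->
  lambda q' <= enorm xi -> enorm xi <= 3 / 2 * lambda q' -> phi_ chi q xi = 0.
Proof.
move=> q0 q0' qq' x1 x2; have [lt_qq'|le_q'q] := ltP q q'.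
  by apply: phi_large => //; exact: le_trans (lambda_ge2 _ _ lt_qq') _.
have lt_q'q : q' < q by rewrite lt_neqAle eq_sym qq'.
apply: phi_small; first exact: le_trans q0' (ltW _).
by have := lambda_ge2 _ _ lt_q'q; lra.
Qed.

End Cutoff.

(** * Blocks as finite sums and as integral operators *)

Section Blocks.
Context {R : realType}.
Variables (chi : vec3 R -> R) (hchi : cutoff chi).
Implicit Types (x y : vec3 R) (q : int) (k l : int * int * int).
Local Notation T3 := (torus_measure R).
Local Notation V := ((2 * pi) ^+ 3 : R).
Local Open Scope complex_scope.

Definition box_point (M : nat) (t : 'I_(2 * M).+1 * 'I_(2 * M).+1 * 'I_(2 * M).+1) :
    int * int * int :=
  (t.1.1%:Z - M%:Z, t.1.2%:Z - M%:Z, t.2%:Z - M%:Z).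

(** For [q >= 0] this is [2 * lambda q], the radius outside which [phi_ chi q] vanishes; at [q = -1]
    it is 4, more than the radius 1. A symmetric cube of this size turns the sum over all
    frequencies into an explicit finite sum. *)
Definition freq_bound q : nat := 2 ^ `|q|.+1.

Definition box q := [seq box_point (freq_bound q) t | t in predT].

Lemma box_uniq q : uniq (box q).
Proof.
rewrite map_inj_uniq ?enum_uniq// => -[[a b] c] [[a' b'] c'] [] /=.
by move=> /addIr[/ord_inj->] /addIr[/ord_inj->] /addIr[/ord_inj->].
Qed.

Lemma size_box q : size (box q) = ((2 * freq_bound q).+1 ^ 3)%N.
Proof. by rewrite size_map -cardE !card_prod !card_ord !expnS expn0 muln1 mulnA. Qed.

Lemma lambda_freq_bound q : -1 <= q -> 2 * lambda q <= (freq_bound q)%:R :> R.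
Proof.
move=> q1; rewrite /freq_bound natrX exprS ler_pM2l// /lambda.
case: q q1 => [n _|[|n//] _]; first by rewrite lexx.
by rewrite NegzE exprN1/= expr1; lra.
Qed.

Lemma phi_box q l : -1 <= q -> l \notin box q -> phi_ chi q (vec_of_int l) = 0.
Proof.
move=> q1; apply: contraNeq => pl.
set M := freq_bound q.
have lM i : `|crd (vec_of_int l) i : R| <= M%:R.
  apply: le_trans (crd_le_enorm _ _) _; apply: le_trans (lambda_freq_bound _ q1).
  by rewrite leNgt; apply: contra pl => /ltW/(phi_large chi hchi q _ q1) ->.
have coord (z : int) : `|z%:~R : R| <= M%:R ->
    exists t : 'I_(2 * M).+1, z = t%:Z - M%:Z.
  rewrite -intr_norm -[M%:R]/((M%:Z)%:~R) ler_int => zM.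
  have zM' : (absz (z + M%:Z)%R < (2 * M).+1)%N by lia.
  by exists (Ordinal zM') => /=; lia.
have [t0 e0] := coord _ (lM 0); have [t1 e1] := coord _ (lM 1).
have [t2 e2] := coord _ (lM 2).
apply/mapP; exists (t0, t1, t2); rewrite ?mem_enum// /box_point/= -e0 -e1 -e2.
by case: l {pl lM e0 e1 e2} => [[]].
Qed.

(** On the indices of the box, [rev_ord] in each coordinate is the reflection of frequencies. This
    makes the blocks of a real field real. *)
Lemma box_sum_odd q (F : int * int * int -> R) : (forall l, F (- l) = - F l) ->
  \sum_(l <- box q) F l = 0.
Proof.
move=> oF; have : \sum_(l <- box q) F l = - \sum_(l <- box q) F l.
  rewrite /box big_map big_enum/= -sumrN.
  pose r (t : 'I_(2 * freq_bound q).+1 * 'I_(2 * freq_bound q).+1 * 'I_(2 * freq_bound q).+1) :=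
    (rev_ord t.1.1, rev_ord t.1.2, rev_ord t.2).
  have rK : involutive r by case=> [[a b] c]; rewrite /r /= !rev_ordK.
  rewrite (reindex_inj (inv_inj rK))/=; apply: eq_bigr => t _.
  rewrite -oF; congr F; case: t => [[a b] c]; rewrite /box_point /r/=.
  have := ltn_ord a; have := ltn_ord b; have := ltn_ord c.
  by move=> ? ? ?; congr (_, _, _); rewrite /=; lia.
by move=> h; lra.
Qed.

(** The bracket is the cosine of [l . (x - y)]: up to the volume, a block is a convolution with this
    kernel, written with [x] and [y] separated. *)
Definition block_kernel q x y : R :=
  \sum_(l <- box q) phi_ chi q (vec_of_int l) * (cosk l x * cosk l y + sink l x * sink l y).

Lemma lp_block_sum q v i x : -1 <= q -> lp_block chi q v i x =
  \sum_(l <- box q) fourier v i l * (phi_ chi q (vec_of_int l))%:C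
     * expi (dot (vec_of_int l) x).
Proof.
move=> q1; rewrite /lp_block (fsbigE (box q)); first last.
- by move=> l _ lb; rewrite phi_box// mulr0 mul0r.
- by [].
- exact: box_uniq.
by apply: eq_bigl => l; rewrite in_setT.
Qed.

Lemma ReD (z w : R[i]) : complex.Re (z + w) = complex.Re z + complex.Re w.
Proof. by case: z w => [a b] [c d]. Qed.

Lemma ImD (z w : R[i]) : complex.Im (z + w) = complex.Im z + complex.Im w.
Proof. by case: z w => [a b] [c d]. Qed.

Lemma lp_block_Re q v i x : -1 <= q -> square_integrable (v i) ->
  complex.Re (lp_block chi q v i x) = V^-1 * \int[T3]_y (v i y * block_kernel q x y).
Proof.
move=> q1 sv; rewrite lp_block_sum// (big_morph _ ReD (erefl _ : complex.Re 0 = 0)).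
under [in RHS]eq_Rintegral do rewrite mulr_sumr.
have ic l := tintegrableM _ _ sv (square_integrable_cosk l).
have is_ l := tintegrableM _ _ sv (square_integrable_sink l).
have E l y : v i y * (phi_ chi q (vec_of_int l) * (cosk l x * cosk l y + sink l x * sink l y))
  = (phi_ chi q (vec_of_int l) * cosk l x) * (v i y * cosk l y)
    + (phi_ chi q (vec_of_int l) * sink l x) * (v i y * sink l y) by ring.
rewrite tintegral_sum => [|l]; last first.
  under eq_fun do rewrite E.
  by apply: tintegrableD; apply: tintegrableZ.
rewrite mulr_sumr; apply: eq_bigr => l _.
under [in RHS]eq_Rintegral do rewrite E.
rewrite tintegralD ?tintegralZ//; [|exact: tintegrableZ|exact: tintegrableZ].
rewrite /fourier /expi /=; simpc => /=.
rewrite -/(cosk l x) -/(sink l x) /cosk /sink; ring.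
Qed.

Lemma lp_block_Im q v i x : -1 <= q -> square_integrable (v i) ->
  complex.Im (lp_block chi q v i x) = 0.
Proof.
move=> q1 sv; rewrite lp_block_sum// (big_morph _ ImD (erefl _ : complex.Im 0 = 0)).
apply: box_sum_odd => l.
have cN : \int[T3]_y (v i y * cosk (- l) y) = \int[T3]_y (v i y * cosk l y).
  by apply: eq_Rintegral => y _; rewrite coskN.
have sN : \int[T3]_y (v i y * sink (- l) y) = - \int[T3]_y (v i y * sink l y).
  rewrite -[RHS]mulN1r -tintegralZ; last exact: tintegrableM sv (square_integrable_sink l).
  by apply: eq_Rintegral => y _; rewrite sinkN; ring.
rewrite vec_of_intN phi_even// /fourier /expi /=; simpc => /=.
rewrite -vec_of_intN -/(cosk (- l)) -/(sink (- l)) -/(cosk l) -/(sink l) cN sN.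
by rewrite /cosk /sink vec_of_intN dotNl cosN sinN; ring.
Qed.

End Blocks.

(** * The components of the datum *)

Section Wave.
Context {R : realType}.
Implicit Types (x y v w : vec3 R) (k l : int * int * int) (n : nat).
Local Notation T3 := (torus_measure R).
Local Notation V := ((2 * pi) ^+ 3 : R).

Local Notation cube n := ('I_n * 'I_n * 'I_n)%type.

(** Sums of two modes have coordinates between [10 n] and [12 n], hence norm between 10 sqrt(3) n >
    16 n and 12 sqrt(3) n < 24 n. This is inside the annulus of [phi_one] for [lambda q = 16 n],
    which is why [n = 2 ^ p] goes with [q = p + 4]. *)
Definition mode n (a : cube n) : int * int * int :=
  ((5 * n + a.1.1)%:Z, (5 * n + a.1.2)%:Z, (5 * n + a.2)%:Z).

(* [rot v] is orthogonal to [v]; the field of amplitude [rot (mode a)] along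
   [mode a + mode b] is divergence-free only after symmetrization in a and b. *)
Definition rot v : vec3 R := (v.1.2, - v.1.1, 0).

Definition wcoef n (a : cube n) i : R := crd (rot (vec_of_int (mode n a))) i.

Definition wave n i x : R :=
  \sum_a \sum_b wcoef n a i * cosk (mode n a + mode n b) x.

Lemma mode_inj n : injective (mode n).
Proof.
move=> [[a b] c] [[a' b'] c'] [] /=.
by move=> /addnI/ord_inj -> /addnI/ord_inj -> /addnI/ord_inj ->.
Qed.

Lemma mode_crd n a i : 5 * n%:R <= (crd (vec_of_int (mode n a)) i : R) <= 6 * n%:R.
Proof.
have E (m : 'I_n) : 5 * n%:R <= (((5 * n + m)%:Z)%:~R : R) <= 6 * n%:R.
  rewrite -[5]/(5%N%:R) -[6]/(6%N%:R) -!natrM -pmulrn !ler_nat.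
  by have := ltn_ord m; lia.
case: a => [[a0 a1] a2]; case: i => [[|[|[|//]]] ?]; rewrite /mode /crd/=; exact: E.
Qed.

Lemma wcoef_le n a i : `|wcoef n a i| <= 6 * n%:R.
Proof.
have n0 : 0 <= n%:R :> R by [].
have H j : `|crd (vec_of_int (mode n a)) j : R| <= 6 * n%:R.
  by have /andP[] := mode_crd n a j; rewrite ler_norml => *; lra.
rewrite /wcoef /rot; case: i => [[|[|[|//]]] ?]; rewrite /crd/=.
- exact: (H 1).
- by rewrite normrN; exact: (H 0).
- by rewrite normr0; lra.
Qed.

Lemma card_cube n : #|{: cube n}| = (n ^ 3)%N.
Proof. by rewrite !card_prod !card_ord !expnS expn0 muln1 mulnA. Qed.

Lemma sum_cube_const n (c : R) : \sum_(a : cube n) c = c * n%:R ^+ 3.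
Proof. by rewrite sumr_const card_cube -[LHS]mulr_natr natrX. Qed.

Lemma measurable_wave n i : measurable_fun [set: mvec3 R] (wave n i : mvec3 R -> R).
Proof.
apply: measurable_sum => a; apply: measurable_sum => b.
by apply: measurable_funM => //; exact: measurable_cosk.
Qed.

Lemma periodic_wave n i : periodic (wave n i).
Proof.
move=> x j; apply: eq_bigr => a _; apply: eq_bigr => b _.
by rewrite (periodic_cosk _).1.
Qed.

Lemma wave_le n i x : `|wave n i x| <= 6 * n%:R ^+ 7.
Proof.
apply: le_trans (ler_norm_sum _ _ _) _.
apply: (@le_trans _ _ (\sum_(a : cube n) \sum_(b : cube n) 6 * n%:R)).
  apply: ler_sum => a _; apply: le_trans (ler_norm_sum _ _ _) _.
  apply: ler_sum => b _; rewrite normrM -[leRHS]mulr1.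
  by apply: ler_pM => //; [exact: wcoef_le|exact: cosk_le1].
rewrite !sum_cube_const.
by rewrite le_eqVlt; apply/orP; left; apply/eqP; ring.
Qed.

Lemma tintegrable_wave n i : torus_integrable (wave n i).
Proof. exact: tintegrable_bounded (measurable_wave n i) (wave_le n i). Qed.

(** With the exponential sums [C + sqrt(-1) S] over the modes, the double sum is the real part of a
    product of two of them. The weights [1 / n] and [n] in the arithmetic-geometric inequality
    compensate the coefficients of size [n] in the first factor. Parseval then gives 18 n^4 + n^4 /
    2, rounded up to 19 n^4. *)
Lemma wave_norm_integral n i : (0 < n)%N ->
  \int[T3]_x `|wave n i x| <= V * (19 * n%:R ^+ 4).
Proof.
move=> n0; have n1 : 0 < n%:R :> R by rewrite ltr0n.
pose C (c : cube n -> R) x := \sum_a (c a * cosk (mode n a) x + 0 * sink (mode n a) x).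
pose S (c : cube n -> R) x := \sum_a (c a * sink (mode n a) x - 0 * cosk (mode n a) x).
have CS c : torus_integrable (fun x => C c x ^+ 2 + S c x ^+ 2) /\
    \int[T3]_x (C c x ^+ 2 + S c x ^+ 2) = V * \sum_a c a ^+ 2.
  split.
    apply: tintegrableD.
      apply: (square_integrable_sum _ _ _ _).2 => a.
      by apply: square_integrableD; apply: square_integrableZ;
        [exact: square_integrable_cosk|exact: square_integrable_sink].
    apply: (square_integrable_sum _ _ _ _).2 => a.
    under eq_fun do rewrite mul0r subr0.
    by apply: square_integrableZ; exact: square_integrable_sink.
  rewrite (trig_parseval _ _ (mode n) c (fun=> 0)) ?index_enum_uniq//.
    by congr (_ * _); apply: eq_bigr => a _; rewrite expr0n addr0.
  by move=> a b _ _; exact: mode_inj.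
pose one (a : cube n) : R := 1; pose w (a : cube n) := wcoef n a i.
have [iw Iw] := CS w; have [i1 I1] := CS one.
have waveE x : wave n i x = C w x * C one x - S w x * S one x.
  rewrite /C /S !big_distrlr/= -sumrB; apply: eq_bigr => a _.
  by rewrite -sumrB; apply: eq_bigr => b _; rewrite /one coskD /w; ring.
apply: (@le_trans _ _ (\int[T3]_x ((2 * n%:R)^-1 * (C w x ^+ 2 + S w x ^+ 2) +
    n%:R / 2 * (C one x ^+ 2 + S one x ^+ 2)))).
  apply: le_tintegral.
  - by have := integrable_norm (tintegrable_wave n i).
  - by apply: tintegrableD; apply: tintegrableZ.
  - move=> x; rewrite waveE.
    move: (C w x) (C one x) (S w x) (S one x) => cw c1 sw s1.
    (* The sign [s] treats both halves of the absolute value at once; the last term vanishes for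
       [s ^+ 2 = 1]. *)
    have e (s : R) : (2 * n%:R)^-1 * (cw ^+ 2 + sw ^+ 2) + n%:R / 2 * (c1 ^+ 2 + s1 ^+ 2)
      - s * (cw * c1 - sw * s1) = (2 * n%:R)^-1 * ((cw - s * n%:R * c1) ^+ 2 +
        (sw + s * n%:R * s1) ^+ 2) + n%:R / 2 * (1 - s ^+ 2) * (c1 ^+ 2 + s1 ^+ 2).
      by field; rewrite gt_eqF.
    have p (s : R) : s ^+ 2 = 1 -> s * (cw * c1 - sw * s1) <=
       (2 * n%:R)^-1 * (cw ^+ 2 + sw ^+ 2) + n%:R / 2 * (c1 ^+ 2 + s1 ^+ 2).
      move=> s1'; rewrite -subr_ge0 e s1' subrr mulr0 mul0r addr0.
      by rewrite mulr_ge0 ?addr_ge0 ?sqr_ge0 ?invr_ge0 ?mulr_ge0.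
    rewrite ler_norml lerNl -mulN1r p ?sqrrN ?expr1n//=.
    by rewrite -[leLHS]mul1r p ?expr1n.
rewrite tintegralD ?tintegralZ ?Iw ?I1//; [|exact: tintegrableZ|exact: tintegrableZ].
have Sw : \sum_a w a ^+ 2 <= 36 * n%:R ^+ 5.
  apply: (@le_trans _ _ (\sum_(a : cube n) 36 * n%:R ^+ 2)).
    apply: ler_sum => a _; rewrite -real_normK ?num_real//.
    have := wcoef_le n a i; rewrite -/(w a); have := normr_ge0 (w a).
    move: n1 => /ltW; nra.
  rewrite sum_cube_const.
  by rewrite le_eqVlt; apply/orP; left; apply/eqP; ring.
have S1 : \sum_a one a ^+ 2 = n%:R ^+ 3.
  by rewrite /one; under eq_bigr do rewrite expr1n; rewrite sum_cube_const mul1r.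
rewrite S1 (_ : V * (19 * n%:R ^+ 4) = (2 * n%:R)^-1 * (V * (36 * n%:R ^+ 5)) +
   n%:R / 2 * (V * n%:R ^+ 3) + V * (n%:R ^+ 4 / 2)); last by field; rewrite gt_eqF.
have V0 := @tvol_gt0 R.
have VZ : 0 <= V * (n%:R ^+ 4 / 2).
  by apply: mulr_ge0; [exact: ltW|rewrite divr_ge0// exprn_ge0].
rewrite -addrA lerD//; last by rewrite lerDl.
by rewrite ler_wpM2l ?invr_ge0 ?mulr_ge0// ler_wpM2l// ltW.
Qed.

(** As [rot a] is orthogonal to [a], only [rot a . b = a_2 b_1 - a_1 b_2] is left, a determinant up
    to sign. *)
Lemma wcoef_antisym n (a b : cube n) :
  \sum_j wcoef n a j * (crd (vec_of_int (mode n a + mode n b)) j : R) =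
  - \sum_j wcoef n b j * crd (vec_of_int (mode n b + mode n a)) j.
Proof.
rewrite !big_ord_recl !big_ord0 /wcoef !vec_of_intD !crdD /rot /crd/=; ring.
Qed.

Lemma tintegral_cosk_derive psi j k : smooth psi -> periodic psi ->
  \int[T3]_x (cosk k x * 'D_(basis3 j) psi x) =
  crd (vec_of_int k) j * \int[T3]_x (sink k x * psi x).
Proof.
move=> spsi ppsi; have [cpsi dpsi] := spsi [::]; have [cdpsi _] := spsi [:: basis3 j].
have pdpsi := periodic_derive _ (basis3 j) ppsi.
have [M1 psiM] := continuous_periodic_bounded _ cpsi ppsi.
have [M2 dpsiM] := continuous_periodic_bounded _ cdpsi pdpsi.
have sp : square_integrable psi.
  by apply: square_integrable_bounded psiM; exact: continuous_measurable_vec3.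
have sd : square_integrable ('D_(basis3 j) psi).
  by apply: square_integrable_bounded dpsiM; exact: continuous_measurable_vec3.
set c := crd _ _.
have dcos (x : vec3 R) : is_derive x (basis3 j) (cosk k) (- c * sink k x).
  rewrite coskE; apply: is_derive_eq; first exact: is_derive_trig.
  by rewrite dot_basis3 sinkE /trig -/c; ring.
pose F x := cosk k x * psi x.
have dF x : is_derive x (basis3 j) F (cosk k x * 'D_(basis3 j) psi x - c * (sink k x * psi x)).
  have dp := derivableP (dpsi x (basis3 j)).
  have : is_derive x (basis3 j) (cosk k * psi)
      (cosk k x *: 'D_(basis3 j) psi x + psi x *: (- c * sink k x)).
    by have dc := dcos x; exact: is_deriveM.
  by move/is_derive_eq; apply; rewrite /GRing.scale/=; ring.
have DF : 'D_(basis3 j) F = fun x => cosk k x * 'D_(basis3 j) psi x - c * (sink k x * psi x).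
  by apply/funext => x; have [_ ->] := dF x.
have ic := tintegrableM _ _ (square_integrable_cosk k) sd.
have is_ := tintegrableM _ _ (square_integrable_sink k) sp.
have : \int[T3]_x 'D_(basis3 j) F x = 0.
  apply: Rintegral_derive.
  - by move=> x i; rewrite /F (periodic_cosk k).1 ppsi.
  - by move=> x; have [] := dF x.
  - rewrite DF => x; apply: cvgB.
      by apply: cvgM; [rewrite coskE; exact: continuous_trig|exact: cdpsi].
    apply: cvgMl_tmp.
    by apply: cvgM; [rewrite sinkE; exact: continuous_trig|exact: cpsi].
rewrite DF tintegralB ?tintegralZ//; last exact: tintegrableZ.
by move/eqP; rewrite subr_eq0 => /eqP.
Qed.

Lemma wave_divfree n psi : smooth psi -> periodic psi ->
  \sum_j \int[T3]_x (wave n j x * 'D_(basis3 j) psi x) = 0.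
Proof.
move=> spsi ppsi.
have sd j : square_integrable ('D_(basis3 j) psi).
  have [cd _] := spsi [:: basis3 j].
  have [M dM] := continuous_periodic_bounded _ cd (periodic_derive _ (basis3 j) ppsi).
  by apply: square_integrable_bounded dM; exact: continuous_measurable_vec3.
pose B k := \int[T3]_x (sink k x * psi x).
pose A (a b : cube n) := \sum_j wcoef n a j * (crd (vec_of_int (mode n a + mode n b)) j : R).
have E j : \int[T3]_x (wave n j x * 'D_(basis3 j) psi x) =
    \sum_a \sum_b wcoef n a j * (crd (vec_of_int (mode n a + mode n b)) j *
       B (mode n a + mode n b)).
  have ic k := tintegrableM _ _ (square_integrable_cosk k) (sd j).
  transitivity (\int[T3]_x \sum_a \sum_b
      wcoef n a j * (cosk (mode n a + mode n b) x * 'D_(basis3 j) psi x)).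
    apply: eq_Rintegral => x _; rewrite mulr_suml; apply: eq_bigr => a _.
    by rewrite mulr_suml; apply: eq_bigr => b _; rewrite mulrA.
  rewrite tintegral_sum => [|a]; last first.
    by apply: tintegrable_sum => b; exact: tintegrableZ.
  apply: eq_bigr => a _; rewrite tintegral_sum => [|b]; last exact: tintegrableZ.
  by apply: eq_bigr => b _; rewrite tintegralZ// tintegral_cosk_derive.
have -> : \sum_j \int[T3]_x (wave n j x * 'D_(basis3 j) psi x) =
    \sum_a \sum_b A a b * B (mode n a + mode n b).
  under eq_bigr do rewrite E.
  rewrite exchange_big; apply: eq_bigr => a _.
  rewrite exchange_big; apply: eq_bigr => b _.
  by rewrite /A mulr_suml; apply: eq_bigr => j _; rewrite mulrA.
(* Exchanging [a] and [b] keeps the frequency, hence [B], and changes the sign of [A]. *)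
set S := \sum_a _; suff : S = - S by lra.
rewrite {1}/S exchange_big -sumrN; apply: eq_bigr => a _.
rewrite -sumrN; apply: eq_bigr => b _.
by rewrite {1}/A wcoef_antisym -/(A a b) mulNr addrC.
Qed.

Lemma tintegral_cosk_cosk k l : k != 0 ->
  \int[T3]_x (cosk k x * cosk l x) = V / 2 *+ (l == k) + V / 2 *+ (l == - k).
Proof.
move=> k0; transitivity (\int[T3]_x (2^-1 * cosk (l - k) x + 2^-1 * cosk (l + k) x)).
  apply: eq_Rintegral => x _; rewrite !coskD coskN sinkN; field => //.
rewrite tintegralD ?tintegralZ//; try apply: tintegrableZ; try exact: tintegrable_cosk.
by rewrite !(tintegral_cosk_sink _).1 subr_eq0 addr_eq0 !mulrnAr mulrC.
Qed.

Lemma tintegral_cosk_sink0 k l : \int[T3]_x (cosk k x * sink l x) = 0.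
Proof.
transitivity (\int[T3]_x (2^-1 * sink (l - k) x + 2^-1 * sink (l + k) x)).
  apply: eq_Rintegral => x _; rewrite !sinkD coskN sinkN; field => //.
rewrite tintegralD ?tintegralZ//; try apply: tintegrableZ; try exact: tintegrable_sink.
by rewrite !(tintegral_cosk_sink _).2 mulr0 addr0.
Qed.

Lemma block_kernel_cosk (chi : vec3 R -> R) (hchi : cutoff chi) q k x : -1 <= q ->
  k != 0 ->
  \int[T3]_y (cosk k y * block_kernel chi q x y) = V * (phi_ chi q (vec_of_int k) * cosk k x).
Proof.
move=> q1 k0; pose f l := phi_ chi q (vec_of_int l) : R.
transitivity (\int[T3]_y \sum_(l <- box q) ((f l * cosk l x) * (cosk k y * cosk l y) +
   (f l * sink l x) * (cosk k y * sink l y))).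
  apply: eq_Rintegral => y _; rewrite mulr_sumr; apply: eq_bigr => l _; rewrite /f; ring.
have ic l := tintegrableM _ _ (square_integrable_cosk k) (square_integrable_cosk l : square_integrable (cosk l : vec3 R -> R)).
have is_ l := tintegrableM _ _ (square_integrable_cosk k) (square_integrable_sink l : square_integrable (sink l : vec3 R -> R)).
rewrite tintegral_sum => [|l]; last by apply: tintegrableD; apply: tintegrableZ.
(* To be applied to [k] and [- k], each of which carries half of the cosine. For a frequency outside
   the box both sides vanish, by [phi_box]. *)
have delta (g : int * int * int -> R) k' : \sum_(l <- box q) f l * g l *+ (l == k') = f k' * g k'.
  have [kb|kb] := boolP (k' \in box q).
    rewrite (bigD1_seq k')//= ?box_uniq// eqxx mulr1n big1 ?addr0// => l /negbTE ->.
    by rewrite mulr0n.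
  rewrite /f phi_box// mul0r big1_seq// => l /andP[_ lb].
  by case: eqP lb kb => [-> ->|].
transitivity (\sum_(l <- box q) (f l * (cosk l x * (V / 2)) *+ (l == k) +
   f l * (cosk l x * (V / 2)) *+ (l == - k))).
  apply: eq_bigr => l _.
  rewrite tintegralD ?tintegralZ//; [|exact: tintegrableZ|exact: tintegrableZ].
  by rewrite tintegral_cosk_sink0 mulr0 addr0 tintegral_cosk_cosk// mulrDr !mulrnAr !mulrA.
by rewrite big_split/= !delta coskN /f vec_of_intN phi_even//; field.
Qed.

Lemma mode_sum_crd n (a b : cube n) i :
  10 * n%:R <= (crd (vec_of_int (mode n a + mode n b)) i : R) <= 12 * n%:R.
Proof.
have := mode_crd n a i; have := mode_crd n b i; rewrite vec_of_intD crdD.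
by move=> /andP[? ?] /andP[? ?]; apply/andP; split; lra.
Qed.

Lemma mode_sum_enorm n (a b : cube n) :
  16 * n%:R <= (enorm (vec_of_int (mode n a + mode n b)) : R) <= 24 * n%:R.
Proof.
have n0 : 0 <= n%:R :> R by [].
set k := vec_of_int _.
have E : dot k k = crd k 0 ^+ 2 + crd k 1 ^+ 2 + crd k 2 ^+ 2.
  by rewrite /dot !big_ord_recl big_ord0 addr0 addrA !expr2.
have /andP[h0 h0'] := mode_sum_crd n a b 0; have /andP[h1 h1'] := mode_sum_crd n a b 1.
have /andP[h2 h2'] := mode_sum_crd n a b 2.
rewrite -/k in h0 h0' h1 h1' h2 h2'.
have sq (c t : R) : 0 <= c -> c * n%:R <= t -> (c * n%:R) ^+ 2 <= t ^+ 2.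
  by move=> c0 ct; rewrite ler_sqr ?nnegrE ?mulr_ge0//; apply: le_trans ct; rewrite mulr_ge0.
have sq' (t : R) : 0 <= t -> t <= 12 * n%:R -> t ^+ 2 <= (12 * n%:R) ^+ 2.
  by move=> t0 ct; rewrite ler_sqr ?nnegrE ?mulr_ge0.
have p0 : 0 <= 10 * n%:R :> R by rewrite mulr_ge0.
have nn := sqr_ge0 (n%:R : R).
apply/andP; split.
  rewrite -[leLHS]ger0_norm ?mulr_ge0// -sqrtr_sqr /enorm ler_sqrt ?dot_ge0// E.
  have := sq 10 _ ltac:(by []) h0; have := sq 10 _ ltac:(by []) h1.
  have := sq 10 _ ltac:(by []) h2; rewrite !exprMn; lra.
rewrite -[leRHS]ger0_norm ?mulr_ge0// -sqrtr_sqr /enorm ler_sqrt ?sqr_ge0// E.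
have := sq' _ (le_trans p0 h0) h0'; have := sq' _ (le_trans p0 h1) h1'.
have := sq' _ (le_trans p0 h2) h2'; rewrite !exprMn; lra.
Qed.

Lemma mode_sum_neq0 n (a b : cube n) : (0 < n)%N -> mode n a + mode n b != 0.
Proof.
move=> n0; apply/eqP => e; have /andP[+ _] := mode_sum_crd n a b 0.
rewrite e /crd/=; apply/negP; rewrite -ltNge.
by rewrite mulr_gt0// ltr0n.
Qed.

Lemma lambda_shift p : lambda (p + 4)%:Z = 16 * (2 ^ p)%:R :> R.
Proof. by rewrite /lambda -exprnP exprD natrX mulrC; congr (_ * _); ring. Qed.

Lemma wave_block (chi : vec3 R -> R) (hchi : cutoff chi) p q i x : -1 <= q ->
  \int[T3]_y (wave (2 ^ p) i y * block_kernel chi q x y) =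
  V * (wave (2 ^ p) i x *+ (q == (p + 4)%:Z)).
Proof.
move=> q1; set n := (2 ^ p)%N.
have n0 : (0 < n)%N by rewrite expn_gt0.
have sK : square_integrable (block_kernel chi q x).
  apply: square_integrable_sum => l; apply: square_integrableZ.
  by apply: square_integrableD; apply: square_integrableZ;
    [exact: square_integrable_cosk|exact: square_integrable_sink].
have ic k := tintegrableM _ _ (square_integrable_cosk k) sK.
transitivity (\int[T3]_y \sum_a \sum_b
    wcoef n a i * (cosk (mode n a + mode n b) y * block_kernel chi q x y)).
  apply: eq_Rintegral => y _; rewrite mulr_suml; apply: eq_bigr => a _.
  by rewrite mulr_suml; apply: eq_bigr => b _; rewrite mulrA.
rewrite tintegral_sum => [|a]; last by apply: tintegrable_sum => b; exact: tintegrableZ.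
rewrite /wave -!sumrMnl mulr_sumr; apply: eq_bigr => a _.
rewrite tintegral_sum => [|b]; last exact: tintegrableZ.
rewrite -!sumrMnl mulr_sumr; apply: eq_bigr => b _.
rewrite tintegralZ// block_kernel_cosk ?mode_sum_neq0//.
have /andP[e1 e2] := mode_sum_enorm n a b.
have [->|qp] := eqVneq q (p + 4)%:Z.
  rewrite phi_one ?lambda_shift//; first by rewrite mul1r mulr1n mulrCA.
  by lra.
rewrite (phi_other _ hchi _ (p + 4)%:Z) ?lambda_shift//; first by rewrite mul0r mulr0n !mulr0.
by lra.
Qed.

Lemma cos_ge_half : exists2 eta : R, 0 < eta & forall t : R, `|t| <= eta -> 1 / 2 <= cos t.
Proof.
have h : \forall t \near (0 : R), 1 / 2 < cos t.
  by have /cvgr_gt H := @continuous_cos R 0; apply: H; rewrite cos0; lra.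
have [e /= e0 he] := (nbhs_ballP _ _).1 h.
exists (e / 2) => [|t te]; first by rewrite divr_gt0.
apply: ltW; apply: he; rewrite /ball/= sub0r normrN; lra.
Qed.

(** In component 1 all coefficients [- crd _ 0] have one sign and size at least [5 n]. Once every
    cosine is at least 1/2, the [n ^ 6] terms add up without cancellation. *)
Lemma wave_lower : exists2 kappa : R, 0 < kappa <= 1 & forall n x, (0 < n)%N ->
  (forall i, 0 <= crd x i <= kappa / n%:R) -> 5 / 2 * n%:R ^+ 7 <= `|wave n 1 x|.
Proof.
have [eta eta0 heta] := cos_ge_half.
(* Three coordinates at most [12 n], against [kappa / n], bound the phase by [36 * kappa]. The
   minimum with 1 will keep the cube inside the cell. *)
exists (Num.min 1 (eta / 36)).
  by rewrite lt_min ltr01 divr_gt0//= ge_min lexx.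
move=> n x n0 hx; have n1 : 0 < n%:R :> R by rewrite ltr0n.
have cosge a b : 1 / 2 <= cosk (mode n a + mode n b) x.
  apply: heta; apply: le_trans (ler_norm_sum _ _ _) _.
  apply: (@le_trans _ _ (\sum_(i < 3) eta / 3)); last first.
    by rewrite sumr_const card_ord -mulr_natr; lra.
  apply: ler_sum => i _; rewrite normrM.
  have /andP[k1 k2] := mode_sum_crd n a b i; have /andP[x1 x2] := hx i.
  rewrite !ger0_norm//; last by apply: le_trans k1; rewrite mulr_ge0// ltW.
  apply: (@le_trans _ _ (12 * n%:R * (eta / 36 / n%:R))).
    apply: ler_pM => //; first by apply: le_trans k1; rewrite mulr_ge0// ltW.
    by apply: le_trans x2 _; rewrite ler_pM2r ?invr_gt0// ge_min lexx orbT.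
  by rewrite le_eqVlt; apply/orP; left; apply/eqP; field; rewrite gt_eqF.
rewrite -normrN (le_trans _ (ler_norm _))// /wave -sumrN.
have -> : 5 / 2 * n%:R ^+ 7 = \sum_(a : cube n) \sum_(b : cube n) (5 / 2 * n%:R) :> R.
  by rewrite !sum_cube_const; ring.
apply: ler_sum => a _; rewrite -sumrN; apply: ler_sum => b _.
have /andP[m1 _] := mode_crd n a 0; have := cosge a b.
have -> : wcoef n a 1 = - crd (vec_of_int (mode n a)) 0 :> R by [].
move: (cosk _ _) (crd _ _) m1 => c m; nra.
Qed.

End Wave.

(** * Summation of the waves *)

Section Datum.
Context {R : realType}.
Implicit Types (x y v w : vec3 R) (n p : nat) (theta : R).
Local Notation T3 := (torus_measure R).
Local Notation V := ((2 * pi) ^+ 3 : R).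
Local Notation N p := ((2 ^ p)%:R : R).

Lemma scale_gt0 p : 0 < N p. Proof. by rewrite ltr0n expn_gt0. Qed.

Lemma scale_ge1 p : 1 <= N p. Proof. by rewrite ler1n expn_gt0. Qed.

Lemma powR_addr (x r s : R) : 0 < x -> x `^ r * x `^ s = x `^ (r + s).
Proof. by move=> x0; rewrite powRD//; apply/implyP => _; rewrite gt_eqF. Qed.

Lemma powR_scale p (r : R) : N p `^ r = (2 `^ r) ^+ p.
Proof.
rewrite natrX -powR_mulrn// -powRrM mulrC powRrM powR_mulrn ?powR_ge0//.
Qed.

Definition amp theta p : R := N p `^ (- theta - 4).

Lemma amp_gt0 theta p : 0 < amp theta p. Proof. by apply: powR_gt0; exact: scale_gt0. Qed.

Lemma amp_pow theta p m : amp theta p * N p ^+ m = N p `^ (m%:R - theta - 4).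
Proof.
rewrite /amp -powR_mulrn ?ltW ?scale_gt0// powR_addr ?scale_gt0//; congr (_ `^ _); ring.
Qed.

Lemma amp_wave_sup theta p i x : `|amp theta p * wave (2 ^ p) i x| <= 6 * N p `^ (3 - theta).
Proof.
rewrite normrM gtr0_norm ?amp_gt0// (le_trans (ler_wpM2l (ltW (amp_gt0 _ _)) (wave_le _ _ _)))//.
by rewrite mulrCA amp_pow (_ : 7%:R - theta - 4 = 3 - theta)//; ring.
Qed.

Lemma amp_wave_int theta p i :
  \int[T3]_x `|amp theta p * wave (2 ^ p) i x| <= 19 * V * N p `^ (- theta).
Proof.
have iw : torus_integrable (fun x => `|wave (2 ^ p) i x|).
  by have := integrable_norm (@tintegrable_wave R (2 ^ p) i).
rewrite (_ : \int[T3]_x _ = amp theta p * \int[T3]_x `|wave (2 ^ p) i x|); last first.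
  rewrite -tintegralZ//; apply: eq_Rintegral => x _.
  by rewrite normrM gtr0_norm// amp_gt0.
apply: le_trans (ler_wpM2l (ltW (amp_gt0 _ _)) (wave_norm_integral _ _ _)) _.
  by rewrite expn_gt0.
rewrite (_ : - theta = 4%:R - theta - 4) ?lerr -?amp_pow; last by ring.
by rewrite le_eqVlt; apply/orP; left; apply/eqP; ring.
Qed.

(** Sup norm times L^1 norm: 114 = 6 * 19, and the exponents [3 - theta] and [- theta] add up. The
    bound is put in the form required by [square_summable_series]; its ratio is below 1 exactly for
    [theta > 3 / 2]. *)
Lemma amp_wave_sq theta p i :
  (\int[T3]_x ((amp theta p * wave (2 ^ p) i x) ^+ 2)%:E <=
    (114 * V * (2 `^ ((3 - 2 * theta) / 2)) ^+ (2 * p))%:E)%E.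
Proof.
pose f x := amp theta p * wave (2 ^ p) i x.
have mf : measurable_fun [set: mvec3 R] (f : mvec3 R -> R).
  by apply: measurable_funM => //; exact: measurable_wave.
have if_ : torus_integrable f.
  by apply: tintegrableZ; exact: tintegrable_wave.
have inf : torus_integrable (fun x => `|f x|) by exact: (integrable_norm if_).
have isq : torus_integrable (fun x => f x ^+ 2).
  exact: (square_integrable_bounded _ _ mf (amp_wave_sup theta p i)).2.
rewrite -(fineK (integrable_fin_num _ isq))// lee_fin.
apply: (@le_trans _ _ (\int[T3]_x (6 * N p `^ (3 - theta) * `|f x|))).
  apply: le_tintegral => //; first exact: tintegrableZ.
  move=> x; rewrite -real_normK ?num_real// expr2.
  by apply: ler_wpM2r => //; exact: amp_wave_sup.
rewrite tintegralZ//; apply: le_trans (ler_wpM2l _ (amp_wave_int theta p i)) _.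
  by rewrite mulr_ge0// powR_ge0.
rewrite mulnC exprM -powR_scale -[X in _ <= _ * X]powR_mulrn ?powR_ge0// -powRrM.
rewrite (_ : (3 - 2 * theta) / 2 * 2%:R = (3 - theta) + (- theta)); last by field.
rewrite -(powR_addr _ (3 - theta) (- theta)) ?scale_gt0//.
by rewrite le_eqVlt; apply/orP; left; apply/eqP; ring.
Qed.

(** Afterwards the datum is known only through this convergence. Block kernels and derivatives of
    test functions are bounded, so it determines the blocks and gives the vanishing divergence. *)
Lemma datum_exists theta : 3 / 2 < theta -> exists u0 : @vfield R, L2field u0 /\
  forall i (g : vec3 R -> R) (M : R), measurable_fun [set: mvec3 R] (g : mvec3 R -> R) ->
    (forall x, `|g x| <= M) ->
    (fun n => \sum_(0 <= p < n) amp theta p * \int[T3]_x (wave (2 ^ p) i x * g x)) @ \oo -->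
      \int[T3]_x (u0 i x * g x).
Proof.
move=> theta32; pose rho : R := 2 `^ ((3 - 2 * theta) / 2).
have rho01 : 0 < rho < 1.
  by rewrite powR_gt0//= /rho /powR pnatr_eq0/= expR_lt1 nmulr_rlt0; rewrite ?ln_gt0 ?ltr1n//; lra.
have fin : (T3 setT < +oo)%E by rewrite torus_measureT ltry.
have /choice[u0 hu0] : forall i, exists F : vec3 R -> R, L2fun F /\
  forall (g : vec3 R -> R) (M : R), measurable_fun [set: mvec3 R] (g : mvec3 R -> R) ->
    (forall x, `|g x| <= M) ->
    (fun n => \sum_(0 <= p < n) amp theta p * \int[T3]_x (wave (2 ^ p) i x * g x)) @ \oo -->
      \int[T3]_x (F x * g x).
  move=> i; pose f p (x : mvec3 R) : R := amp theta p * wave (2 ^ p) i x.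
  have mf p : measurable_fun setT (f p).
    by apply: measurable_funM => //; exact: measurable_wave.
  have [F [mF F2 Fper Fg]] := square_summable_series _ _ _ T3 f rho _ fin rho01 mf
    (fun p => amp_wave_sq theta p i).
  exists F; split.
    split => // x j; apply: Fper => p.
    by rewrite /f periodic_wave.
  move=> g M mg gM; have := Fg g M mg gM; apply: cvg_trans.
  rewrite (_ : (fun n => _) = (fun n => \sum_(0 <= p < n) \int[T3]_x (f p x * g x)))//.
  apply/funext => n; apply: eq_bigr => p _; rewrite -tintegralZ.
    by apply: eq_Rintegral => x _; rewrite mulrA.
  apply: tintegrableM; first exact: square_integrable_bounded (measurable_wave _ _) (wave_le _ _).
  exact: square_integrable_bounded gM.
exists u0; split => [i|i]; first by have [] := hu0 i.
by have [_] := hu0 i.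
Qed.

End Datum.

(** * Upper and lower bounds on Lebesgue norms *)

Section LnormBounds.
Context d (T : measurableType d) (R : realType).
Variable mu : {measure set T -> \bar R}.
Implicit Types (f : T -> R) (r A B c m : R).

(** Interpolation between L^1 and the sup norm, from the pointwise bound of [f ^ r] by
    [A ^ (r - 1) * f]. *)
Lemma Lnorm_interp_le f r A B : 1 < r -> measurable_fun setT f ->
  (forall x, 0 <= f x <= A) -> (\int[mu]_x (f x)%:E <= B%:E)%E ->
  (Lnorm mu r%:E (fun x => (f x)%:E) <= ((A `^ (r - 1) * B) `^ r^-1)%:E)%E.
Proof.
move=> r1 mf fA fB; have r0 : 0 < r by apply: lt_trans r1.
have f0 x : 0 <= f x by have /andP[] := fA x.
rewrite unlock /=.
under eq_integral => x _ do rewrite /= ger0_norm//.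
have mfr : measurable_fun setT (fun x => (f x `^ r)%:E).
  by apply/measurable_EFinP; apply: (measurableT_comp (measurable_powR r)).
have le1 : (\int[mu]_x (f x `^ r)%:E <= (A `^ (r - 1) * B)%:E)%E.
  apply: (@le_trans _ _ (\int[mu]_x (A `^ (r - 1) * f x)%:E)%E).
    apply: ge0_le_integral => //.
    - by move=> x _; rewrite lee_fin powR_ge0.
    - by apply/measurable_EFinP; exact: measurable_funM.
    - move=> x _; rewrite lee_fin.
      have /andP[] := fA x; rewrite le_eqVlt => /predU1P[<- _|fx0 fxA].
        by rewrite powR0 ?mulr0// gt_eqF.
      have -> : f x `^ r = f x `^ (r - 1) * f x.
        by rewrite -[X in _ = _ * X](powRr1 (f0 x)) powR_addr// subrK.
      rewrite ler_wpM2r//.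
      by apply: ge0_ler_powR => //; rewrite ?nnegrE ?subr_ge0// ltW// (lt_le_trans fx0).
  under eq_integral do rewrite EFinM.
  rewrite ge0_integralZl//; last 3 first.
  - exact/measurable_EFinP.
  - by move=> x _; rewrite lee_fin.
  - by rewrite lee_fin powR_ge0.
  by rewrite EFinM lee_wpmul2l// lee_fin powR_ge0.
have i0 : (0 <= \int[mu]_x (f x `^ r)%:E)%E.
  by apply: integral_ge0 => x _; rewrite lee_fin powR_ge0.
have ri0 : 0 <= r^-1 by rewrite invr_ge0 ltW.
by apply: (gt0_ler_poweR ri0 _ _ le1); rewrite in_itv/= leey ?i0// (le_trans i0 le1).
Qed.

Lemma Lnorm_pinfty_le f A : 0 <= A -> (forall x, `|f x| <= A) ->
  (Lnorm mu +oo%E (fun x => (f x)%:E) <= A%:E)%E.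
Proof.
move=> A0 fA; rewrite unlock /=; case: ifPn => _; last by rewrite lee_fin.
by apply/ess_supP; apply: aeW => x /=; rewrite lee_fin.
Qed.

(** Chebyshev's inequality. *)
Lemma Lnorm_fin_ge f (D : set T) r c m : 0 < r -> measurable_fun setT f -> measurable D ->
  0 <= c -> 0 <= m -> (m%:E <= mu D)%E -> (forall x, D x -> c <= `|f x|) ->
  ((c * m `^ r^-1)%:E <= Lnorm mu r%:E (fun x => (f x)%:E))%E.
Proof.
move=> r0 mf mD c0 m0 mmu cf; rewrite unlock /=.
have mfr : measurable_fun setT (fun x => (`|f x| `^ r)%:E).
  by apply/measurable_EFinP; apply: (measurableT_comp (measurable_powR r));
    exact: measurableT_comp.
have le1 : ((c `^ r * m)%:E <= \int[mu]_x (`|f x| `^ r)%:E)%E.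
  apply: (@le_trans _ _ (\int[mu]_(x in D) (`|f x| `^ r)%:E)%E); last first.
    by apply: ge0_subset_integral => // x _; rewrite lee_fin powR_ge0.
  apply: (@le_trans _ _ (\int[mu]_(x in D) (c `^ r)%:E)%E).
    by rewrite integral_cst// EFinM lee_wpmul2l// lee_fin powR_ge0.
  apply: ge0_le_integral => //.
  - by move=> x _; rewrite lee_fin powR_ge0.
  - exact: measurable_funS mfr.
  - move=> x Dx; rewrite lee_fin; apply: ge0_ler_powR; rewrite ?nnegrE//; [exact: ltW|exact: cf].
have -> : c * m `^ r^-1 = (c `^ r * m) `^ r^-1.
  by rewrite powRM ?powR_ge0// -powRrM divff ?gt_eqF// powRr1.
have cm0 : (0%:E <= (c `^ r * m)%:E)%E by rewrite lee_fin mulr_ge0// powR_ge0.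
have ri0 : 0 <= r^-1 by rewrite invr_ge0 ltW.
by apply: (gt0_ler_poweR ri0 _ _ le1); rewrite in_itv/= leey ?cm0// (le_trans cm0 le1).
Qed.

Lemma Lnorm_pinfty_ge f (D : set T) c : measurable D -> (0 < mu D)%E ->
  (forall x, D x -> c <= `|f x|) ->
  (c%:E <= Lnorm mu +oo%E (fun x => (f x)%:E))%E.
Proof.
move=> mD D0 cf; rewrite unlock /=.
have T0 : (0 < mu setT)%E by apply: lt_le_trans D0 _; rewrite le_measure ?inE.
rewrite T0 leNgt; apply/negP => lt.
have := ess_sup_ge mu (abse \o (fun x => (f x)%:E)) => -[Z [mZ Z0 sub]].
have DZ : D `<=` Z.
  move=> x Dx; apply: sub => /= le; have := cf x Dx.
  by rewrite -lee_fin leNgt (le_lt_trans le lt).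
have : (mu D <= mu Z)%E by rewrite le_measure ?inE.
by rewrite Z0 leNgt D0.
Qed.

End LnormBounds.

(** * Divergence and blocks of the datum *)

Section DatumBlocks.
Context {R : realType}.
Variables (chi : vec3 R -> R) (hchi : cutoff chi).
Implicit Types (x y v w : vec3 R) (n p : nat) (q : int).
Local Notation T3 := (torus_measure R).
Local Notation V := ((2 * pi) ^+ 3 : R).
Local Notation N p := ((2 ^ p)%:R : R).

Lemma cmod_ge (z : 'I_3 -> R[i]) i : `|complex.Re (z i)| <= cmod z.
Proof.
rewrite -sqrtr_sqr /cmod ler_sqrt; last first.
  by apply: sumr_ge0 => j _; rewrite addr_ge0 ?sqr_ge0.
rewrite (bigD1 i)//= -addrA lerDl addr_ge0 ?sqr_ge0//.
by apply: sumr_ge0 => j _; rewrite addr_ge0 ?sqr_ge0.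
Qed.

Lemma cmod_le (z : 'I_3 -> R[i]) : (forall i, complex.Im (z i) = 0) ->
  cmod z <= \sum_i `|complex.Re (z i)|.
Proof.
move=> z0; rewrite /cmod -[leRHS]ger0_norm ?sumr_ge0// -sqrtr_sqr ler_sqrt ?sqr_ge0//.
rewrite !big_ord_recl !big_ord0 !z0 !addr0 expr0n !addr0.
move: (complex.Re _) (complex.Re _) (complex.Re _) => a b c.
rewrite -[a ^+ 2]real_normK ?num_real// -[b ^+ 2]real_normK ?num_real//.
rewrite -[c ^+ 2]real_normK ?num_real//.
have := normr_ge0 a; have := normr_ge0 b; have := normr_ge0 c; nra.
Qed.

Definition block_coef q (u : vfield) i (l : int * int * int) : R * R :=
  (V^-1 * (phi_ chi q (vec_of_int l) * \int[T3]_y (u i y * cosk l y)),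
   V^-1 * (phi_ chi q (vec_of_int l) * \int[T3]_y (u i y * sink l y))).

Lemma lp_block_Re_trig q (u : vfield) i x : -1 <= q ->
  complex.Re (lp_block chi q u i x) =
  \sum_(l <- box q) ((block_coef q u i l).1 * cosk l x + (block_coef q u i l).2 * sink l x).
Proof.
move=> q1; rewrite lp_block_sum// (big_morph _ ReD (erefl _ : complex.Re 0 = 0)).
apply: eq_bigr => l _; rewrite /fourier /expi /real_complex_def /=.
rewrite /block_coef /cosk /sink /=; ring.
Qed.

Lemma measurable_cmod_block q (u : vfield) : -1 <= q -> (forall i, square_integrable (u i)) ->
  measurable_fun [set: mvec3 R] ((fun x => cmod (lp_block chi q u ^~ x)) : mvec3 R -> R).
Proof.
move=> q1 su.
have mRe i : measurable_fun [set: mvec3 R]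
    ((fun x => complex.Re (lp_block chi q u i x)) : mvec3 R -> R).
  rewrite (_ : (fun x => _) = fun x => \sum_(l <- box q)
    ((block_coef q u i l).1 * cosk l x + (block_coef q u i l).2 * sink l x)).
    apply: measurable_sum => l; apply: measurable_funD; apply: measurable_funM => //.
      exact: measurable_cosk.
    exact: measurable_sink.
  by apply/funext => x; exact: lp_block_Re_trig.
rewrite (_ : (fun x => _) = Num.sqrt \o
    (fun x => \sum_i (complex.Re (lp_block chi q u i x)) ^+ 2)).
  apply: measurableT_comp; first by apply: continuous_measurable_fun; exact: sqrt_continuous.
  by apply: measurable_sum => i; exact: measurable_funX.
apply/funext => x; rewrite /cmod/=; congr Num.sqrt; apply: eq_bigr => i _.
by rewrite (lp_block_Im chi hchi)// expr0n addr0.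
Qed.

Variables (theta : R) (u0 : @vfield R).
Hypothesis Lu0 : L2field u0.
Hypothesis lim_u0 : forall i (g : vec3 R -> R) (M : R),
  measurable_fun [set: mvec3 R] (g : mvec3 R -> R) -> (forall x, `|g x| <= M) ->
  (fun n => \sum_(0 <= p < n) amp theta p * \int[T3]_x (wave (2 ^ p) i x * g x)) @ \oo -->
  \int[T3]_x (u0 i x * g x).

Lemma datum_divfree : divfree u0.
Proof.
move=> psi spsi ppsi.
have bd j : exists M, measurable_fun [set: mvec3 R] ('D_(basis3 j) psi : mvec3 R -> R) /\
    forall x, `|'D_(basis3 j) psi x| <= M.
  have [cd _] := spsi [:: basis3 j].
  have [M dM] := continuous_periodic_bounded _ cd (periodic_derive _ (basis3 j) ppsi).
  by exists M; split; first exact: continuous_measurable_vec3.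
have sd j : square_integrable ('D_(basis3 j) psi).
  by have [M [mM dM]] := bd j; exact: square_integrable_bounded dM.
rewrite tintegral_sum => [|j]; last first.
  by apply: tintegrableM => //; exact: L2fun_square_integrable.
have lim : (fun n => \sum_j \sum_(0 <= p < n) amp theta p *
    \int[T3]_x (wave (2 ^ p) j x * 'D_(basis3 j) psi x)) @ \oo -->
    \sum_j \int[T3]_x (u0 j x * 'D_(basis3 j) psi x).
  apply: cvg_big => [|j _]; first exact: add_continuous.
  have [M [mM dM]] := bd j; exact: lim_u0 mM dM.
rewrite -(cvg_lim _ lim)//; apply: lim_near_cst => //; apply: nearW => n.
rewrite exchange_big big1// => p _; rewrite -mulr_sumr wave_divfree//.
by rewrite mulr0.
Qed.

Lemma block_kernel_bounded q x : exists M,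
  measurable_fun [set: mvec3 R] (block_kernel chi q x : mvec3 R -> R) /\
  forall y, `|block_kernel chi q x y| <= M.
Proof.
exists (\sum_(l <- box q) `|phi_ chi q (vec_of_int l)| * 2); split.
  apply: measurable_sum => l; apply: measurable_funM => //.
  by apply: measurable_funD; apply: measurable_funM => //;
    [exact: measurable_cosk|exact: measurable_sink].
move=> y; apply: le_trans (ler_norm_sum _ _ _) _; apply: ler_sum => l _.
rewrite normrM ler_wpM2l// (le_trans (ler_normD _ _))// !normrM.
by rewrite -[leRHS](_ : 1 * 1 + 1 * 1 = 2); [apply: lerD; apply: ler_pM|ring];
  rewrite ?cosk_le1 ?sink_le1.
Qed.

Lemma datum_block_cvg q i x : -1 <= q ->
  (fun n => \sum_(0 <= p < n) amp theta p * (wave (2 ^ p) i x *+ (q == (p + 4)%:Z))) @ \oo -->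
  complex.Re (lp_block chi q u0 i x).
Proof.
move=> q1; have [M [mM bM]] := block_kernel_bounded q x.
have V0 := @tvol_gt0 R.
rewrite lp_block_Re//; last exact: L2fun_square_integrable.
rewrite (_ : (fun n => _) = (fun n => V^-1 * \sum_(0 <= p < n) amp theta p *
   \int[T3]_y (wave (2 ^ p) i y * block_kernel chi q x y))).
  by apply: cvgMl_tmp; exact: lim_u0 mM bM.
apply/funext => n; rewrite mulr_sumr; apply: eq_bigr => p _.
by rewrite wave_block// mulrCA mulKf// gt_eqF.
Qed.

Lemma datum_block p i x : complex.Re (lp_block chi (p + 4)%:Z u0 i x) =
  amp theta p * wave (2 ^ p) i x.
Proof.
have lim := @datum_block_cvg (p + 4)%:Z i x ltac:(by []).
rewrite -(cvg_lim _ lim)//; apply: lim_near_cst => //.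
exists p.+1 => // n /= pn.
rewrite (bigD1_seq p) ?iota_uniq ?mem_index_iota//= eqxx mulr1n big1 ?addr0// => p' p'p.
rewrite (_ : _ == _ = false) ?mulr0n ?mulr0//; apply/negbTE; apply: contra p'p.
by rewrite eqz_nat eqn_add2r eq_sym.
Qed.

Lemma datum_block0 q i x : -1 <= q -> (forall p, q != (p + 4)%:Z) ->
  complex.Re (lp_block chi q u0 i x) = 0.
Proof.
move=> q1 qp; have lim := @datum_block_cvg q i x q1.
rewrite -(cvg_lim _ lim)//; apply: lim_near_cst => //; apply: nearW => n.
by rewrite big1// => p _; rewrite (negbTE (qp p)) mulr0n mulr0.
Qed.

End DatumBlocks.

(** * Besov norm of the datum and decay of the blocks of an H^1 field *)

Section BesovBounds.
Context {R : realType}.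
Variables (chi : vec3 R -> R) (hchi : cutoff chi).
Implicit Types (x y : vec3 R) (n p : nat) (q : int).
Local Notation T3 := (torus_measure R).
Local Notation V := ((2 * pi) ^+ 3 : R).
Local Notation N p := ((2 ^ p)%:R : R).

Lemma besov_weight p (s : R) : lambda (p + 4)%:Z `^ s = 16 `^ s * N p `^ s.
Proof. by rewrite lambda_shift powRM. Qed.

Lemma datum_besov_finite (theta : R) (u0 : @vfield R) (r : \bar R) : L2field u0 ->
  (forall p i x, complex.Re (lp_block chi (p + 4)%:Z u0 i x) = amp theta p * wave (2 ^ p) i x) ->
  (forall q i x, -1 <= q -> (forall p, q != (p + 4)%:Z) ->
     complex.Re (lp_block chi q u0 i x) = 0) ->
  (1%:E < r)%E ->
  (besov_norm chi (three_over r + theta - 3)%R r u0 < +oo)%E.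
Proof.
move=> Lu0 blk blk0 r1; set s := three_over r + theta - 3.
have su0 i : square_integrable (u0 i) by exact: L2fun_square_integrable.
suff [K K0 HK] : exists2 K, 0 <= K & forall p, ((lambda (p + 4)%:Z `^ s)%:E *
    Lnorm T3 r (fun x => (cmod (lp_block chi (p + 4)%:Z u0 ^~ x))%:E) <= K%:E)%E.
  apply: (@le_lt_trans _ _ K%:E); last exact: ltry.
  apply: ge_ereal_sup => _ [q /= q1 <-].
  have [[p ->]|qp] := pselect (exists p, q = (p + 4)%:Z); first exact: HK.
  have z x : cmod (lp_block chi q u0 ^~ x) = 0.
    apply/eqP; rewrite eq_le sqrtr_ge0 andbT.
    apply: le_trans (cmod_le _ _) _ => [i|]; first by rewrite (lp_block_Im chi hchi).
    rewrite big1// => i _; rewrite blk0 ?normr0// => p.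
    by apply/eqP => qE; apply: qp; exists p.
  rewrite (_ : (fun x => _) = cst 0%E); last by apply/funext => x; rewrite z.
  rewrite Lnorm0 ?mule0 ?lee_fin//.
  by apply: contraTneq r1 => ->; rewrite lte_fin ltr10.
pose f p x := cmod (lp_block chi (p + 4)%:Z u0 ^~ x).
have fle p x : f p x <= \sum_i `|amp theta p * wave (2 ^ p) i x|.
  apply: le_trans (cmod_le _ _) _ => [i|]; first by rewrite (lp_block_Im chi hchi).
  by apply: ler_sum => i _; rewrite blk.
(* The three components give 18 = 3 * 6 here and 57 = 3 * 19 in [fB]. *)
have fA p x : 0 <= f p x <= 18 * N p `^ (3 - theta).
  rewrite sqrtr_ge0/= (le_trans (fle p x))//.
  apply: le_trans (ler_sum _ (fun i _ => amp_wave_sup theta p i x)) _.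
  by rewrite sumr_const card_ord -[leLHS]mulr_natr le_eqVlt; apply/orP; left; apply/eqP; ring.
have mf p : measurable_fun [set: mvec3 R] (f p : mvec3 R -> R).
  exact: measurable_cmod_block.
have intf p : torus_integrable (f p).
  apply: (tintegrable_bounded _ (18 * N p `^ (3 - theta)) (mf p)) => x.
  by rewrite ger0_norm; have /andP[] := fA p x.
have fB p : (\int[T3]_x (f p x)%:E <= (57 * V * N p `^ (- theta))%:E)%E.
  rewrite -(fineK (integrable_fin_num _ (intf p)))// lee_fin.
  have iw i : torus_integrable (fun x => `|amp theta p * wave (2 ^ p) i x|).
    by apply: integrable_norm; apply: tintegrableZ; exact: tintegrable_wave.
  apply: (@le_trans _ _ (\int[T3]_x (\sum_i `|amp theta p * wave (2 ^ p) i x|))).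
    by apply: le_tintegral => //; exact: tintegrable_sum.
  rewrite tintegral_sum//.
  apply: le_trans (ler_sum _ (fun i _ => amp_wave_int theta p i)) _.
  by rewrite sumr_const card_ord -[leLHS]mulr_natr le_eqVlt; apply/orP; left; apply/eqP; ring.
have V0 := @tvol_gt0 R.
case: r r1 @s => [r r1|_|//] s.
- rewrite lte_fin in r1; have r0 : 0 < r by apply: lt_trans r1.
  exists (16 `^ s * (18 `^ (r - 1) * (57 * V)) `^ r^-1); first by rewrite mulr_ge0 ?powR_ge0.
  move=> p; have w0 : (0 <= (lambda (p + 4)%:Z `^ s)%:E)%E by rewrite lee_fin powR_ge0.
  apply: le_trans (lee_wpmul2l w0 (Lnorm_interp_le _ _ _ T3 (f p) _ _ _ r1 (mf p) (fA p) (fB p))) _.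
  rewrite -EFinM lee_fin besov_weight.
  have N0 := @scale_gt0 R p.
  have -> : (18 * N p `^ (3 - theta)) `^ (r - 1) * (57 * V * N p `^ (- theta)) =
    (18 `^ (r - 1) * (57 * V)) * N p `^ ((3 - theta) * (r - 1) + - theta).
    rewrite -(powR_addr _ ((3 - theta) * (r - 1)) (- theta))// powRM ?powR_ge0//.
    by rewrite -powRrM; ring.
  rewrite [X in _ * X <= _]powRM ?powR_ge0//; last first.
    by rewrite mulr_ge0 ?powR_ge0// mulr_ge0// ltW.
  rewrite -powRrM mulrACA powR_addr//.
  (* The interpolated exponent [((3 - theta) * (r - 1) - theta) / r] equals [3 - theta - 3 / r],
     which is [- s] for every [r]. *)
  rewrite (_ : s + _ = 0) ?powRr0 ?mulr1// /s /=; field.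
  by rewrite gt_eqF.
- exists (16 `^ s * 18); first by rewrite mulr_ge0 ?powR_ge0.
  move=> p; have w0 : (0 <= (lambda (p + 4)%:Z `^ s)%:E)%E by rewrite lee_fin powR_ge0.
  have A0 : 0 <= 18 * N p `^ (3 - theta) by rewrite mulr_ge0 ?powR_ge0.
  have fA' x : `|f p x| <= 18 * N p `^ (3 - theta).
    by rewrite ger0_norm; have /andP[] := fA p x.
  apply: le_trans (lee_wpmul2l w0 (Lnorm_pinfty_le _ _ _ T3 (f p) _ A0 fA')) _.
  rewrite -EFinM lee_fin besov_weight mulrACA powR_addr ?scale_gt0//.
  by rewrite (_ : s + _ = 0) ?powRr0 ?mulr1// /s /=; ring.
Qed.

(** Bessel's inequality for the gradient bounds the sum of [|l| ^ 2 * E l], so over the shell the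
    squares [E l] sum to [O(S / lambda ^ 2)]. Summed over [O(lambda ^ 3)] frequencies, the block is
    at most a multiple of [eta * lambda + S / eta]. A small fixed [eta] controls the first term, and
    the second does not depend on [p]. *)
Lemma h1_block_small (v : @vfield R) G : L2field v -> weak_gradient v G ->
  exists p0, forall p, (p0 <= p)%N -> forall i x,
    `|complex.Re (lp_block chi (p + 4)%:Z v i x)| <= N p.
Proof.
move=> Lv vG; have sv i : square_integrable (v i) by exact: L2fun_square_integrable.
have sG i j : square_integrable (G i j) by apply: L2fun_square_integrable; have [] := vG i j.
have [B B0 hB] := phi_bounded chi hchi.
have V0 := @tvol_gt0 R.
pose S := \sum_i \sum_j V * \int[T3]_x (G i j x ^+ 2).
have G20 i j : 0 <= V * \int[T3]_x (G i j x ^+ 2).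
  by apply: mulr_ge0; [exact: ltW|apply: tintegral_ge0 => x; exact: sqr_ge0].
have SS i : \sum_j V * \int[T3]_x (G i j x ^+ 2) <= S.
  rewrite /S [leRHS](bigD1 i)//= lerDl; apply: sumr_ge0 => i' _; exact: sumr_ge0.
have S0 : 0 <= S by apply: sumr_ge0 => i _; exact: sumr_ge0.
(* The box has [(64 N + 1) ^ 3 <= (5 * lambda q) ^ 3] points and [lambda q = 16 N]; this [eta] makes
   their share exactly [N / 2]. The choice of [p0] bounds the remaining share by [4 / 9 * N], which
   is below [N / 2]. *)
pose eta := V / (B * 125 * 16 * 2); have eta0 : 0 < eta by rewrite divr_gt0// !mulr_gt0.
have [p0 hp0] : exists p0, forall p, (p0 <= p)%N -> 4 * (V^-1 * B * (S / eta)) <= N p.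
  have [p0 hp0] : exists p0 : nat, 4 * (V^-1 * B * (S / eta)) <= p0%:R.
    exists (Num.truncn (4 * (V^-1 * B * (S / eta)))).+1.
    exact/ltW/truncnS_gt.
  exists p0 => p p0p; apply: le_trans hp0 _; rewrite ler_nat (leq_trans p0p)//.
  exact/ltnW/ltn_expl.
exists p0 => p /hp0 hp i x; set q := (p + 4)%:Z.
have q0 : 0 <= q by []. have q1 : -1 <= q by [].
have N0 := @scale_gt0 R p; have N1 := @scale_ge1 R p.
have l0 : 0 < lambda q :> R by exact: lambda_gt0.
have lE : lambda q = 16 * N p :> R by exact: lambda_shift.
rewrite lp_block_Re_trig//.
pose a l := \int[T3]_y (v i y * cosk l y); pose b l := \int[T3]_y (v i y * sink l y).
pose E l := a l ^+ 2 + b l ^+ 2.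
(* Below this threshold [phi_ chi q] vanishes; above it [|l| ^ 2] is at least
   [9 / 16 * lambda q ^ 2], the source of the factor 16/9. *)
pose big l := 3 / 4 * lambda q < enorm (vec_of_int l : vec3 R).
have E0 l : 0 <= E l by rewrite addr_ge0 ?sqr_ge0.
have bes : \sum_(l <- box q) lambda q ^+ 2 * (if big l then E l else 0) <= 16 / 9 * S.
  have gradE l : dot (vec_of_int l) (vec_of_int l) * E l =
    \sum_j ((\int[T3]_y (G i j y * cosk l y)) ^+ 2 + (\int[T3]_y (G i j y * sink l y)) ^+ 2).
    rewrite /dot mulr_suml; apply: eq_bigr => j _.
    have [gc gs] := @weak_gradient_coef R v G i j l (sv i) vG.
    by rewrite -gc -[_ ^+ 2 in X in _ = _ + X]sqrrN -gs /E /a /b; ring.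
  apply: (@le_trans _ _ (\sum_(l <- box q) 16 / 9 * (dot (vec_of_int l) (vec_of_int l) * E l))).
    apply: ler_sum => l _; case: ifPn => [bl|_]; last first.
      by rewrite mulr0 !mulr_ge0// ?dot_ge0.
    rewrite mulrA ler_wpM2r//.
    have : (3 / 4 * lambda q) ^+ 2 <= enorm (vec_of_int l : vec3 R) ^+ 2.
      by rewrite ler_sqr ?nnegrE ?sqrtr_ge0 ?mulr_ge0 ?ltW.
    rewrite /enorm sqr_sqrtr ?dot_ge0//.
    by rewrite exprMn; move: (dot _ _) (lambda q ^+ 2) => c d; lra.
  rewrite -mulr_sumr ler_wpM2l//; apply: le_trans (SS i).
  under eq_bigr do rewrite gradE.
  rewrite exchange_big; apply: ler_sum => j _.
  exact: bessel (sG i j) (box_uniq q).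
(* [e] balances the two sides of [|a| + |b| <= e + (a ^+ 2 + b ^+ 2) / e], summed
   over O(lambda ^+ 3) frequencies. *)
set e := eta / lambda q ^+ 2.
have e0 : 0 < e by rewrite divr_gt0// exprn_gt0.
apply: (@le_trans _ _ (\sum_(l <- box q) V^-1 * B * (e + e^-1 * (if big l then E l else 0)))).
  apply: le_trans (ler_norm_sum _ _ _) _; apply: ler_sum => l _.
  apply: le_trans (ler_normD _ _) _; rewrite !normrM.
  have bl0 : 0 <= e + e^-1 * (if big l then E l else 0).
    apply: addr_ge0; first exact: ltW.
    by apply: mulr_ge0; [rewrite invr_ge0; exact: ltW|case: ifP].
  have Vi : `|V^-1| = V^-1 by rewrite gtr0_norm// invr_gt0.
  rewrite /block_coef/= ?normrM Vi.
  rewrite -/(a l) -/(b l).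
  have [bl|sl] := boolP (big l); last first.
    have -> : phi_ chi q (vec_of_int l) = 0 by apply: phi_small => //; rewrite leNgt.
    rewrite normr0 !(mul0r, mulr0, addr0).
    by apply: mulr_ge0; [apply: mulr_ge0; [rewrite invr_ge0|]|]; exact: ltW.
  have := hB q (vec_of_int l); set P := `|phi_ _ _ _| => hP.
  have P0 : 0 <= P by rewrite normr_ge0.
  have := @cosk_le1 R l x; have := @sink_le1 R l x.
  set c := `|cosk _ _|; set d := `|sink _ _| => d1 c1.
  apply: (@le_trans _ _ (V^-1 * (P * (`|a l| + `|b l|)))).
    have VP0 z : 0 <= V^-1 * (P * `|z|) by rewrite !mulr_ge0// invr_ge0 ltW.
    rewrite [leRHS](_ : _ = V^-1 * (P * `|a l|) * 1 + V^-1 * (P * `|b l|) * 1); last by ring.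
    by apply: lerD; exact: ler_wpM2l.
  rewrite -[leRHS]mulrA; apply: ler_wpM2l; first by rewrite invr_ge0 ltW.
  apply: ler_pM; [exact: P0|exact: addr_ge0|exact: hP|].
  rewrite /E -[a l ^+ 2]real_normK ?num_real// -[b l ^+ 2]real_normK ?num_real//.
  move: `|a l| `|b l| => A1 B1.
  rewrite -subr_ge0 (_ : _ - _ = e^-1 * ((A1 - e / 2) ^+ 2 + (B1 - e / 2) ^+ 2) + e / 2).
    have ei : 0 <= e^-1 by rewrite invr_ge0 ltW.
    have e2 : 0 <= e / 2 by rewrite divr_ge0// ltW.
    by rewrite addr_ge0// mulr_ge0// addr_ge0// sqr_ge0.
  by field; rewrite gt_eqF.
rewrite -mulr_sumr big_split/= -[X in _ * (_ + X)]mulr_sumr.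
rewrite big_const_seq count_predT iter_addr_0 size_box.
have L1 : 1 <= lambda q :> R by rewrite lE; lra.
have card : e *+ (2 * freq_bound q).+1 ^ 3 <= 125 * 16 * eta * N p.
  have FE : (2 * freq_bound q).+1%:R = 64 * N p + 1 :> R.
    by rewrite -[LHS]natr1 natrM /freq_bound /q /= !expnS expnD !natrM; ring.
  have F3 : (2 * freq_bound q).+1%:R ^+ 3 <= (5 * lambda q) ^+ 3 :> R.
    by rewrite FE lE; apply: lerXn2r; rewrite ?nnegrE; lra.
  rewrite -[leLHS]mulr_natr natrX; apply: le_trans (ler_wpM2l (ltW e0) F3) _.
  rewrite le_eqVlt; apply/orP; left; apply/eqP.
  by rewrite /e lE; field; rewrite gt_eqF.
have tail : e^-1 * (\sum_(l <- box q) (if big l then E l else 0)) <= 16 / 9 * S / eta.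
  rewrite /e invf_div mulrAC ler_pM2r ?invr_gt0// mulr_sumr.
  exact: bes.
have VB0 : 0 <= V^-1 * B by rewrite mulr_ge0 ?invr_ge0//; exact: ltW.
apply: le_trans (ler_wpM2l VB0 (lerD card tail)) _.
have -> : V^-1 * B * (125 * 16 * eta * N p + 16 / 9 * S / eta) =
   N p / 2 + 4 / 9 * (4 * (V^-1 * B * (S / eta))).
  have etaE : V^-1 * B * (125 * 16 * eta * N p) = N p / 2.
    rewrite /eta; move: (V) V0 => W W0; field.
    by rewrite !gt_eqF.
  rewrite mulrDr etaE -[16 / 9 * S / eta]mulrA; congr (_ + _).
  by move: (V^-1) (S / eta) => c t; field.
lra.
Qed.

End BesovBounds.

(** * Discontinuity at the initial time *)

Section Discontinuity.
Context {R : realType}.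
Implicit Types (x y : vec3 R) (n p : nat) (q : int).
Local Notation T3 := (torus_measure R).
Local Notation V := ((2 * pi) ^+ 3 : R).
Local Notation N p := ((2 ^ p)%:R : R).

(** Based at the origin, not centred there, so that for small [h] it lies in the cell that carries
    the measure. *)
Definition corner (h : R) : set (mvec3 R) :=
  (`[0, h]%classic `*` `[0, h]%classic) `*` `[0, h]%classic.

Lemma measurable_corner h : measurable (corner h).
Proof. by apply: measurableX; first apply: measurableX; exact: measurable_itv. Qed.

Lemma corner_measure h : 0 < h <= 1 -> T3 (corner h) = (h ^+ 3)%:E.
Proof.
move=> /andP[h0 h1]; pose I : set (measurableTypeR R) := `[0, h]%classic.
have mI : measurable I by exact: measurable_itv.
have hpi : h < 2 * pi by have := @pi_ge2 R; lra.
have CI : circle_measure R I = h%:E.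
  rewrite /circle_measure /= /mfrestr /mrestr setIidl.
    by rewrite lebesgue_measure_itv/= lte_fin h0 oppr0 adde0.
  move=> t; rewrite /I/= !in_itv/= => /andP[-> th]/=.
  exact: le_lt_trans hpi.
have CII : (circle_measure R \x circle_measure R)%E (I `*` I) = (h * h)%:E.
  apply: (etrans (product_measure1E _ _ _ _)) => //.
  by rewrite EFinM; congr (_ * _)%E; exact: CI.
apply: (etrans (product_measure1E _ _ _ _)) => //; first exact: measurableX.
by rewrite !exprSr expr0 mul1r EFinM; congr (_ * _)%E; [exact: CII|exact: CI].
Qed.

Lemma corner_crd h x i : corner h x -> 0 <= crd x i <= h.
Proof.
by case: x => [[a b] c] [[]] /=; rewrite !in_itv/=; case: i => [[|[|[|//]]] ?].
Qed.

(** A right neighbourhood of 0 contains an interval of positive length, which the null set of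
    exceptional times cannot cover. *)
Lemma at_right_weak_gradient (T : \bar R) (u : R -> @vfield R) (G : R -> 'I_3 -> @vfield R)
    (W : set R) : (0%:E < T)%E ->
  {ae lebesgue_measure, forall t, [set t : R | 0 < t /\ (t%:E < T)%E] t -> weak_gradient (u t) (G t)} ->
  nbhs (0 : R)^'+ W ->
  exists t, [/\ W t, 0 < t, (t%:E < T)%E & weak_gradient (u t) (G t)].
Proof.
move=> T0 [Z [mZ Z0 sub]] W0.
have [e e0 eW] : exists2 e : R, 0 < e & forall t, 0 < t < e -> W t.
  have [e /= e0 he] := (nbhs_ballP _ _).1 W0; exists e => // t /andP[t0 te].
  by apply: he => //; rewrite /ball/= sub0r normrN gtr0_norm.
have [h h0 [he hT]] : exists2 h : R, 0 < h & h <= e /\ (h%:E <= T)%E.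
  case: T T0 {sub} => [T T0|_|//].
    by exists (Num.min e T); rewrite ?lt_min ?e0// ?lee_fin !ge_min !lexx ?orbT.
  by exists e; rewrite // leey.
apply: contrapT => nt.
have mI : measurable (`]0%R, h[%classic : set (measurableTypeR R)) by exact: measurable_itv.
have : (lebesgue_measure (`]0%R, h[%classic : set R) <= lebesgue_measure Z)%E.
  apply: le_measure; rewrite ?inE//.
  move=> t /=; rewrite in_itv/= => /andP[t0 th]; apply: (sub t) => /= wg.
  have tT : (t%:E < T)%E by apply: lt_le_trans hT; rewrite lte_fin.
  apply: nt; exists t; split => //; last exact: wg.
  by apply: eW; rewrite t0 (lt_le_trans th).
by rewrite Z0 lebesgue_measure_itv/= lte_fin h0 oppr0 adde0 lee_fin leNgt h0.
Qed.

Lemma block_difference (chi : vec3 R -> R) q (v w : @vfield R) i x : cutoff chi -> -1 <= q ->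
  (forall j, square_integrable (v j)) -> (forall j, square_integrable (w j)) ->
  complex.Re (lp_block chi q (fsub v w) i x) =
  complex.Re (lp_block chi q v i x) - complex.Re (lp_block chi q w i x).
Proof.
move=> hchi q1 sv sw; have sub j : square_integrable (fsub v w j).
  have := square_integrableD _ _ (sv j) (square_integrableZ (-1) _ (sw j)).
  rewrite (_ : (fun x => _) = fsub v w j)//.
  by apply/funext => y; rewrite /fsub mulN1r.
have [M [mM bM]] := block_kernel_bounded chi q x.
have sK : square_integrable (block_kernel chi q x) by exact: square_integrable_bounded bM.
rewrite !lp_block_Re// -mulrBr -tintegralB; [|exact: tintegrableM|exact: tintegrableM].
by congr (_ * _); apply: eq_Rintegral => y _; rewrite /fsub mulrBl.
Qed.

End Discontinuity.

Theorem theorem1p1 (R : realType) (chi : vec3 R -> R) (hchi : cutoff chi) :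
  exists delta : R, 0 < delta /\
  forall theta : R, 3 / 2 < theta <= 2 ->
  exists u0 : vfield, L2field u0 /\ divfree u0 /\
  forall r : \bar R, (1%:E < r)%E ->
    (2 <= theta + three_over r < 3 \/
     [/\ ((3 / 2)%:E <= r)%E,
         3 <= theta + three_over r < 4 &
         2 * theta + three_over r <= 11 / 2]) ->
    (besov_norm chi (three_over r + theta - 3)%R r u0 < +oo)%E /\
    forall (mu : R) (T : \bar R) (u : R -> vfield),
      0 < mu -> (0%:E < T)%E -> leray_hopf mu T u0 u ->
      (delta%:E <=
       limf_esup (fun t : R =>
         besov_norm chi (three_over r + theta - 3)%R r (fsub (u t) u0)) 0^'+)%E.
Proof.
have [kappa /andP[k0 k1] hk] := @wave_lower R.
(* [kappa ^+ 3] is a lower bound of kappa^(3/r) for all [r > 1], as [kappa <= 1]; 1/16 is a lower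
   bound of 16^s for all [s >= -1]. Neither depends on [theta], [r] or the solution. *)
exists (kappa ^+ 3 / 16); split; first by rewrite divr_gt0// exprn_gt0.
move=> theta /andP[th1 th2]; have [u0 [Lu0 lim_u0]] := datum_exists theta th1.
have blk := datum_block chi hchi theta u0 Lu0 lim_u0.
have blk0 := datum_block0 chi hchi theta u0 Lu0 lim_u0.
exists u0; split => //; split; first exact: datum_divfree Lu0 lim_u0.
move=> r r1 hr; split; first exact: datum_besov_finite Lu0 blk blk0 r1.
set s := three_over r + theta - 3.
have s1 : -1 <= s.
  by rewrite /s; case: hr => [/andP[? _]|[_ /andP[? _] _]]; lra.
move=> mu T u _ T0 [G [pr [[Lu _] [aeG _] _ _ _]]].
have su0 i : square_integrable (u0 i) by exact: L2fun_square_integrable.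
(* The upper limit is an infimum over neighbourhoods [W] of suprema, so one good time in each [W] is
   enough. *)
apply: le_ereal_inf_tmp => _ [W W0 <-].
have [t [Wt t0 tT wG]] := at_right_weak_gradient _ _ _ _ T0 aeG W0.
have [Lut _] := Lu t (conj (ltW t0) tT).
have sut i : square_integrable (u t i) by exact: L2fun_square_integrable.
apply: le_trans (ereal_sup_ubound _); last by exists t.
(* The index [p] depends on [t], but the lower bound obtained from this single block will not depend
   on [p]. *)
have [p hp] := h1_block_small chi hchi (u t) (G t) Lut wG.
have N0 := @scale_gt0 R p; have N1 := @scale_ge1 R p.
set N := (2 ^ p)%:R : R in N0 N1 *.
set q := (p + 4)%:Z; have q1 : -1 <= q by [].
pose f x := cmod (lp_block chi q (fsub (u t) u0) ^~ x).
have sw i : square_integrable (fsub (u t) u0 i).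
  have := square_integrableD _ _ (sut i) (square_integrableZ (-1) _ (su0 i)).
  rewrite (_ : (fun x => _) = fsub (u t) u0 i)//.
  by apply/funext => y; rewrite /fsub mulN1r.
have mf : measurable_fun [set: mvec3 R] (f : mvec3 R -> R) by exact: measurable_cmod_block.
have h01 : 0 < kappa / N <= 1.
  by rewrite divr_gt0//= ler_pdivrMr// mul1r (le_trans k1).
have flow x : corner (kappa / N) x -> N `^ (3 - theta) <= `|f x|.
  move=> Dx; rewrite (le_trans _ (ler_norm _))// (le_trans _ (cmod_ge _ 1))//.
  rewrite block_difference// distrC blk (le_trans _ (lerB_normD _ _))// normrN.
  have w1 : 5 / 2 * N `^ (3 - theta) <= `|amp theta p * wave (2 ^ p) 1 x|.
    rewrite normrM gtr0_norm ?amp_gt0//.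
    have n0 : (0 < 2 ^ p)%N by rewrite expn_gt0.
    apply: le_trans (ler_wpM2l (ltW (amp_gt0 theta p)) (hk _ _ n0 (fun i => corner_crd _ _ i Dx))).
    by rewrite mulrCA amp_pow (_ : 7%:R - theta - 4 = 3 - theta)//; ring.
  (* Here [theta <= 2] enters: the block of [u t] takes away at most one of the 5/2 units of size
     N^(3-theta), and more than one is left. *)
  have NN : N <= N `^ (3 - theta).
    by rewrite -[leLHS](powRr1 (ltW N0)); apply: ler_powR => //; lra.
  have := hp p (leqnn p) 1 x; rewrite -/q -/N => vN.
  move: w1 NN vN N0; set X := N `^ _; lra.
have fin : ((kappa ^+ 3 / 16)%:E <=
  (lambda q `^ s)%:E * Lnorm (torus_measure R) r (fun x => (f x)%:E))%E.
  have w0 : (0 <= (lambda q `^ s)%:E)%E by rewrite lee_fin powR_ge0.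
  have X0 : 0 <= N `^ (3 - theta) by rewrite powR_ge0.
  have s16 : 1 / 16 <= 16 `^ s :> R.
    have : 16 `^ (-1) <= 16 `^ s :> R by apply: ler_powR => //; rewrite ler1n.
    by rewrite powRN powRr1// div1r.
  have kp : kappa ^+ 3 <= 1 by rewrite exprn_ile1// ltW.
  have mD := corner_measure _ h01.
  case: r r1 {hr} @s s1 f mf flow w0 s16 => [r r1|_|//] s s1 f mf flow w0 s16.
  - rewrite lte_fin in r1; have r0 : 0 < r by apply: lt_trans r1.
    have h30 : 0 <= (kappa / N) ^+ 3 by rewrite exprn_ge0// ltW//; have /andP[] := h01.
    have mDle : (((kappa / N) ^+ 3)%:E <= (torus_measure R) (corner (kappa / N)))%E by rewrite mD.
    apply: le_trans (lee_wpmul2l w0 (Lnorm_fin_ge _ _ _ (torus_measure R) f _ _ _ _ r0 mf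
      (measurable_corner _) X0 h30 mDle flow)).
    rewrite -EFinM lee_fin besov_weight -/N.
    (* The volume of the cube contributes N^(-3/r), so the powers of [N] combine to
       [s + (3 - theta) - 3 / r = 0]. *)
    have -> : ((kappa / N) ^+ 3) `^ r^-1 = kappa `^ (3 / r) * N `^ (- (3 / r)).
      have Ni : N^-1 = N `^ (- 1) by rewrite powRN powRr1// ltW.
      rewrite -powR_mulrn; last by rewrite divr_ge0// ltW.
      by rewrite -powRrM powRM ?powR_ge0 ?(ltW k0)// ?Ni ?powR_ge0// -powRrM mulN1r.
    rewrite [N `^ (3 - theta) * _]mulrCA mulrACA !powR_addr//.
    rewrite (_ : s + _ = 0) ?powRr0 ?mulr1; last by rewrite /s /=; ring.
    rewrite mulrC; apply: ler_pM.
    + by [].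
    + by rewrite exprn_ge0// ltW.
    + by rewrite -div1r.
    have r3 : 3 / r <= 3 by rewrite ler_pdivrMr// ler_peMr// ltW.
    have -> : kappa ^+ 3 = kappa `^ (3 / r) * kappa `^ (3 - 3 / r).
      by rewrite powR_addr// -(powR_mulrn _ (ltW k0)); congr (_ `^ _); ring.
    rewrite -[leRHS]mulr1; apply: ler_wpM2l; first exact: powR_ge0.
    apply: (@le_trans _ _ (1 `^ (3 - 3 / r))); last by rewrite powR1.
    by apply: ge0_ler_powR; rewrite ?nnegrE ?subr_ge0//; exact: ltW.
  - have D0 : (0 < (torus_measure R) (corner (kappa / N)))%E.
      by rewrite mD lte_fin exprn_gt0//; have /andP[] := h01.
    apply: le_trans (lee_wpmul2l w0 (Lnorm_pinfty_ge _ _ _ (torus_measure R) f _ _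
      (measurable_corner _) D0 flow)).
    rewrite -EFinM lee_fin besov_weight -/N -[leRHS]mulrA powR_addr//.
    rewrite (_ : s + _ = 0) ?powRr0 ?mulr1; last by rewrite /s /=; ring.
    by apply: le_trans s16; rewrite ler_wpM2r.
by apply: le_trans fin _; apply: ereal_sup_ubound; exists q.
Qed.
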